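(* For every $n\geq 4$ there exist an $n$-dimensional Riemannian manifold $(M,ds^2)$, with scalar curvature denoted $S^M$, and a closed, two-sided hypersurface $\Sigma\subset M$ such that the following hold: (a) $S^M\geq S_0$ for some constant $S_0\in\mathbb{R}$; (b) $\Sigma$ is strictly area-minimising; (c) with the same constant $S_0$: (i) $\Sigma$ is totally geodesic; (ii) the normal Ricci curvature of $M$ vanishes all along $\Sigma$, i.e. $\mathrm{Ric}^M(\nu,\nu)=0$ at every point of $\Sigma$, where $\nu$ is a unit normal field along $\Sigma$; and (iii) $S^M=S_0$ at every point of $\Sigma$.
   Context: Closed means compact without boundary. Areas of hypersurfaces are computed with respect to the metrics induced from $ds^2$. Strictly area-minimising: $\Sigma$ has area strictly less than that of every other nearby hypersurface, i.e. there is $\varepsilon>0$ such that $A(\Sigma)<A(\Sigma_u)$ for every smooth $u:\Sigma\to(-\varepsilon,\varepsilon)$ that is not identically zero, where $\Sigma_u=\{\exp_x(u(x)\nu(x)):x\in\Sigma\}$ and $\nu$ is a unit normal field along $\Sigma$. *)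

(* Defs.v *)
From HB Require Import structures.
From mathcomp Require Export all_boot all_order all_algebra.
From mathcomp Require Export all_classical all_reals all_analysis.
Export Order.TTheory GRing.Theory Num.Theory.
Export numFieldNormedType.Exports.

Set Implicit Arguments.
Unset Strict Implicit.
Unset Printing Implicit Defensive.

Local Open Scope ring_scope.
Local Open Scope classical_set_scope.

Section Calculus.
Context {R : realType}.

Definition partial n (a : 'I_n) (f : 'rV[R]_n -> R) : 'rV[R]_n -> R :=
  fun x => 'D_(delta_mx 0 a) f x.

(* Only the values of f on U matter when U is open. *)
Fixpoint Ck n (k : nat) (U : set 'rV[R]_n) (f : 'rV[R]_n -> R) : Prop :=
  (forall x, U x -> {for x, continuous f}) /\
  match k with
  | 0 => True
  | k'.+1 => forall a : 'I_n,
      (forall x, U x -> derivable f x (delta_mx 0 a)) /\ Ck k' U (partial a f)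
  end.

Definition smooth_on n (U : set 'rV[R]_n) (f : 'rV[R]_n -> R) : Prop :=
  forall k, Ck k U f.

(* Vectors are rows: the differential of F at x is v |-> v *m jac F x. *)
Definition jac m n (F : 'rV[R]_m -> 'rV[R]_n) (x : 'rV[R]_m) : 'M[R]_(m, n) :=
  \matrix_(a, b) partial a (fun y => F y 0 b) x.

(* Integration against m-dimensional Lebesgue measure, written as an iterated
   integral (Tonelli); it is only applied to nonnegative Borel functions. *)
Fixpoint iint (m : nat) : ('rV[R]_m -> \bar R) -> \bar R :=
  match m with
  | 0 => fun f => f 0
  | m'.+1 => fun f =>
      (\int[lebesgue_measure]_t
         iint (fun y : 'rV[R]_m' => f (row_mx (t%:M : 'rV[R]_1) y)))%E
  end.

End Calculus.

(* A smooth n-manifold without boundary. The atlas is indexed by nat, which is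
   no restriction (manifolds are second countable, and chart domains may be
   empty); conversely a countable atlas makes the space second countable. *)
Record manifold (R : realType) (n : nat) := Manifold {
  mspace :> topologicalType;
  dom : nat -> set mspace;
  crd : nat -> mspace -> 'rV[R]_n;
  prm : nat -> 'rV[R]_n -> mspace;
  mfd_hausdorff : hausdorff_space mspace;
  mfd_cover : forall p, exists i, dom i p;
  mfd_open_dom : forall i, open (dom i);
  mfd_open_cod : forall i, open (crd i @` dom i);
  mfd_crdK : forall i p, dom i p -> prm i (crd i p) = p;
  mfd_crd_cont : forall i p, dom i p -> {for p, continuous (crd i)};
  mfd_prm_cont : forall i x, (crd i @` dom i) x -> {for x, continuous (prm i)};
  mfd_smooth : forall i j (b : 'I_n),
    smooth_on (crd i @` (dom i `&` dom j)) (fun x => crd j (prm i x) 0 b)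
}.
Arguments dom {R n} m.
Arguments crd {R n} m.
Arguments prm {R n} m.

Section Manifolds.
Context {R : realType}.

Definition cod n (M : manifold R n) (i : nat) : set 'rV[R]_n :=
  crd M i @` dom M i.

Definition transition n (M : manifold R n) (i j : nat) : 'rV[R]_n -> 'rV[R]_n :=
  crd M j \o prm M i.

Definition smooth_fun n (M : manifold R n) (u : M -> R) : Prop :=
  forall i, smooth_on (cod M i) (u \o prm M i).

Definition local_rep m n (N : manifold R m) (M : manifold R n) (F : N -> M)
    (i j : nat) : 'rV[R]_m -> 'rV[R]_n :=
  crd M j \o F \o prm N i.

Definition smooth_map m n (N : manifold R m) (M : manifold R n) (F : N -> M) :=
  continuous F /\
  forall i j (b : 'I_n), smooth_on (crd N i @` (dom N i `&` F @^-1` dom M j))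
    (fun x => local_rep F i j x 0 b).

Definition immersion m n (N : manifold R m) (M : manifold R n) (F : N -> M) :=
  smooth_map F /\
  forall i j p, dom N i p -> dom M j (F p) ->
    row_free (jac (local_rep F i j) (crd N i p)).

(* The hypersurface is the image of F. As N is compact and M is Hausdorff, an
   injective immersion is an embedding. *)
Definition closed_hypersurface n (N : manifold R n.-1) (M : manifold R n)
    (F : N -> M) : Prop :=
  [/\ compact [set: N], [set: N] !=set0, injective F & immersion F].

End Manifolds.

Definition inner (R : realType) n (A : 'M[R]_n) (v w : 'rV[R]_n) : R :=
  (v *m A *m w^T) 0 0.

(* The Gram matrices of a Riemannian metric in the charts of M. *)
Record metric (R : realType) n (M : manifold R n) := Metric {
  gram :> nat -> 'rV[R]_n -> 'M[R]_n;
  gram_smooth : forall i (a b : 'I_n),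
    smooth_on (cod M i) (fun x => gram i x a b);
  gram_sym : forall i x, cod M i x -> (gram i x)^T = gram i x;
  gram_pos : forall i x (v : 'rV[R]_n), cod M i x -> v != 0 -> 0 < inner (gram i x) v v;
  gram_change : forall i j p, dom M i p -> dom M j p ->
    let J := jac (transition M i j) (crd M i p) in
    gram i (crd M i p) = J *m gram j (crd M j p) *m J^T
}.

Section Curvature.
Context {R : realType} {n : nat}.
Variable G : 'rV[R]_n -> 'M[R]_n.

Definition christoffel (k a b : 'I_n) (x : 'rV[R]_n) : R :=
  2^-1 * \sum_(l < n) invmx (G x) k l *
    (partial a (fun y => G y l b) x + partial b (fun y => G y l a) x
     - partial l (fun y => G y a b) x).

(* R(d_c, d_d) d_b = \sum_a riemann a b c d *: d_a,
   where R(X, Y) Z = D_X D_Y Z - D_Y D_X Z - D_[X, Y] Z. *)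
Definition riemann (a b c d : 'I_n) (x : 'rV[R]_n) : R :=
  partial c (christoffel a d b) x - partial d (christoffel a c b) x
  + \sum_(e < n) (christoffel a c e x * christoffel e d b x
                  - christoffel a d e x * christoffel e c b x).

Definition ricci (x : 'rV[R]_n) : 'M[R]_n :=
  \matrix_(b, d) \sum_(a < n) riemann a b a d x.

Definition scalar_curvature (x : 'rV[R]_n) : R :=
  \sum_(b < n) \sum_(d < n) invmx (G x) b d * ricci x b d.

End Curvature.

Section Hypersurfaces.
Context {R : realType} {n : nat}.
Variables (M : manifold R n) (g : metric M) (N : manifold R n.-1).

(* A unit normal field along F; nu j p is the row of components of the vector
   at F p in the chart j of M (meaningful when F p lies in that chart). *)
Definition unit_normal_field (F : N -> M) (nu : nat -> N -> 'rV[R]_n) : Prop :=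
  [/\ forall i j p, dom M i (F p) -> dom M j (F p) ->
        nu j p = nu i p *m jac (transition M i j) (crd M i (F p)),
      forall i j (b : 'I_n),
        smooth_on (crd N i @` (dom N i `&` F @^-1` dom M j))
          (fun x => nu j (prm N i x) 0 b),
      forall j p, dom M j (F p) ->
        inner (g j (crd M j (F p))) (nu j p) (nu j p) = 1
    & forall i j p (v : 'rV[R]_n.-1), dom N i p -> dom M j (F p) ->
        inner (g j (crd M j (F p)))
          (v *m jac (local_rep F i j) (crd N i p)) (nu j p) = 0].

(* In charts i of N and j of M, with y the local expression of F:
   h_ab = < d_a d_b y + Gamma(d_a y, d_b y), nu >. *)
Definition second_fundamental_form (F : N -> M) (nu : nat -> N -> 'rV[R]_n)
    (i j : nat) (x : 'rV[R]_n.-1) : 'M[R]_n.-1 :=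
  let y := local_rep F i j in
  \matrix_(a, b) inner (g j (y x))
    (\row_k (partial a (partial b (fun z => y z 0 k)) x
       + \sum_(c < n) \sum_(d < n)
           christoffel (g j) k c d (y x) * jac y x a c * jac y x b d))
    (nu j (prm N i x)).

Definition totally_geodesic (F : N -> M) (nu : nat -> N -> 'rV[R]_n) : Prop :=
  forall i j p, dom N i p -> dom M j (F p) ->
    second_fundamental_form F nu i j (crd N i p) = 0.

Definition geodesic (a b : R) (c : R -> M) : Prop :=
  forall t, a < t < b ->
    {for t, continuous c} /\
    forall i, dom M i (c t) ->
      let y k (s : R) : R := crd M i (c s) 0 k in
      forall k, [/\ derivable (y k) t 1, derivable (derive1 (y k)) t 1 &
        derive1 (derive1 (y k)) t + \sum_(l < n) \sum_(l' < n)
          christoffel (g i) k l l' (crd M i (c t))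
            * derive1 (y l) t * derive1 (y l') t = 0].

(* exp_p(v) is defined and equal to q, where v is given by its components in
   each chart around p. *)
Definition is_exp (p : M) (v : nat -> 'rV[R]_n) (q : M) : Prop :=
  exists (a b : R) (c : R -> M), [/\ a < 0, 1 < b, geodesic a b c, c 0 = p /\ c 1 = q &
    forall i k, dom M i p ->
      derive1 (fun s => crd M i (c s) 0 k) 0 = v i 0 k].

(* The part of the chart i of N not covered by the earlier charts: these
   Borel pieces partition N. *)
Definition fresh_piece (i : nat) : set 'rV[R]_n.-1 :=
  [set x | cod N i x /\ forall k, (k < i)%N -> ~ dom N k (prm N i x)].

(* sqrt (det (F^* g)) in the chart i of N; the value does not depend on the
   chart of M used around F (prm N i x). *)
Definition area_density (F : N -> M) (i : nat) (x : 'rV[R]_n.-1) : R :=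
  let q := F (prm N i x) in
  let j := xget 0%N [set j | dom M j q] in
  let J := jac (local_rep F i j) x in
  Num.sqrt (\det (J *m g j (crd M j q) *m J^T)).

Definition area (F : N -> M) : \bar R :=
  (\sum_(0 <= i <oo)
     iint ((fun x => (area_density F i x)%:E) \_ (fresh_piece i)))%E.

(* G parametrises the hypersurface of all exp_{F p} (u p * nu p). *)
Definition strictly_area_minimising (F : N -> M)
    (nu : nat -> N -> 'rV[R]_n) : Prop :=
  exists2 eps : R, 0 < eps &
    forall u : N -> R, smooth_fun u -> (forall p, - eps < u p < eps) ->
      (exists p, u p != 0) ->
      exists G : N -> M,
        [/\ forall p, is_exp (F p) (fun i => u p *: nu i p) (G p),
            closed_hypersurface G & (area F < area G)%E].

End Hypersurfaces.

(* Main.v *)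
(** Take for M and Sigma the tori R^n/(2 pi Z)^n and R^(n-1)/(2 pi Z)^(n-1),
   with coordinates (t, y, z, x, w) on M and Sigma the slice t = 0. The metric
   is dt^2 + dx^2 + |dw|^2 + h(t, x), where the metric h on the (y, z) torus has
   eigenvalues alpha(t) +- beta(t) and eigenlines turning with x. Turning costs
   scalar curvature: on the slice S = - beta^2 / (2 det h). Writing
   l = (log det h)' / 2 and shear for half the logarithmic derivative of the
   ratio of the eigenvalues,
     S = - 2 l' - 3/2 l^2 - shear^2 / 2 - beta^2 / (2 det h),
     Ric(d_t, d_t) = - l' - (l^2 + shear^2) / 2.
   Here alpha and beta are even and periodic in t, and such that
   det h = 3 + O(t^4) has a strict local minimum at t = 0 while beta^2 / det h
   decreases at order t^2, fast enough to beat the other terms. A graph of a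
   function u over the slice has Gram matrix (grad u)(grad u)^T + g_u, of
   determinant at least det h(u) >= 3, so its area is larger unless u = 0. *)
From HB Require Import structures.
From mathcomp Require Import ring lra generic_quotient.
Require Import Defs.

Set Implicit Arguments.
Unset Strict Implicit.
Unset Printing Implicit Defensive.

Local Open Scope ring_scope.
Local Open Scope classical_set_scope.

(** * Partial derivatives and smoothness *)

(** Four dimensions are what the mechanism takes: the normal direction [t], a two-dimensional fibre
    with eigenlines to turn, and a direction [x] along which they turn. Further coordinates are flat
    factors. Fixed eigenlines would not do: condition (c) makes [l], [l'] and the shear vanish on
    the slice, so that [S_0 = 0], and [S >= 0] then forces [l' <= 0], which turns the slice into a
    maximum of [det h]. With turning, the slices have negative scalar curvature, and letting
    [beta^2] decay away from [t = 0] gives back the curvature that the growth of [det h] consumes.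
    Since (c) also makes the second variation of area vanish on constants, the minimum of [det h]
    has to be degenerate, whence the order [t^4]. Everything is periodic, so one construction of
    tori serves both for M and for Sigma; chart changes are lattice translations, and all geometry
    is computed once on the universal cover. *)

Section RowCons.
Context {R : realType} {m : nat}.

(** The argument of the inner integral in [iint], with [m.+1] for [1 + m] columns, so that the
    recursion of [iint] meets it by conversion. It also puts the normal coordinate in front of the
    slice coordinates. *)
Definition row_cons (t : R) (v : 'rV[R]_m) : 'rV[R]_m.+1 :=
  row_mx (t%:M : 'rV[R]_1) v.

Lemma row_cons0 t v : row_cons t v 0 ord0 = t.
Proof.
have := row_mxEl (t%:M : 'rV[R]_1) v 0 ord0; rewrite [X in _ = X]mxE eqxx mulr1n => {2}<-.
by congr (row_cons t v _ _); exact: val_inj.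
Qed.

Lemma row_consS t v j : row_cons t v 0 (lift ord0 j) = v 0 j.
Proof.
rewrite -(row_mxEr (t%:M : 'rV[R]_1) v 0 j).
by congr (row_cons t v _ _); exact: val_inj.
Qed.

End RowCons.

Lemma near_continuous (T U : topologicalType) (f g : T -> U) x : (\forall y \near x, f y = g y) ->
  {for x, continuous f} -> {for x, continuous g}.
Proof.
move=> fg fc; rewrite /prop_for /continuous_at -(nbhs_singleton fg).
by apply: cvg_trans fc; exact: (near_eq_cvg fg).
Qed.

Section PartialDerivatives.
Context {R : realType} {n : nat}.
Implicit Types (f g : 'rV[R]_n -> R) (x : 'rV[R]_n) (a b : 'I_n) (U : set 'rV[R]_n).

Lemma derive_line f x (v : 'rV[R]_n) d :
  is_derive (0 : R) 1 (fun h : R => f (h *: v + x)) d -> is_derive x v f d.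
Proof.
move=> [df <-]; apply: DeriveDef; first exact/derivable1P.
rewrite /derive; set g1 := fun h => _; set g2 := fun h => h^-1 *: _.
suff -> : g1 = g2 by [].
by rewrite funeqE /g1 /g2 => h /=; rewrite addr0 scale0r add0r [_%:A]mulr1.
Qed.

Lemma near_partial a f g x : (\forall y \near x, f y = g y) ->
  \forall y \near x, partial a f y = partial a g y.
Proof.
move=> /nbhs_interior fg; apply: filterS fg => y; exact: near_eq_derive.
Qed.

Lemma Ck_sub k U U' f : U `<=` U' -> Ck k U' f -> Ck k U f.
Proof.
move=> UU'; elim: k f => [|k IH] f /= [fc fd].
  by split=> // x /UU'/fc.
split=> [x /UU'/fc//|a].
by have [fa /IH] := fd a; split=> // x /UU'/fa.
Qed.

Lemma Ck_pointwise k U f : (forall x, U x -> Ck k [set x] f) -> Ck k U f.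
Proof.
elim: k f => [|k IH] f H /=.
  by split=> // x Ux; have [+ _] := H x Ux; apply.
split=> [x Ux|a].
- by have [+ _] := H x Ux; apply.
- split=> [x Ux|].
    by have [_ /(_ a)[+ _]] := H x Ux; apply.
  by apply: IH => x Ux; have [_ /(_ a)[]] := H x Ux.
Qed.

Lemma Ck_near k x f g : (\forall y \near x, f y = g y) ->
  Ck k [set x] f -> Ck k [set x] g.
Proof.
elim: k f g => [|k IH] f g fg /= [fc fd].
  by split=> // _ ->; apply: near_continuous fg _; exact: fc.
split=> [_ ->|a]; first by apply: near_continuous fg _; exact: fc.
have [fa fk] := fd a; split.
  by move=> _ ->; apply: near_eq_derivable fg _; exact: fa.
by apply: IH fk; exact: near_partial.
Qed.

(** Chart expressions on a torus agree with a global formula only near each point, and the formula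
    changes between components of a chart overlap; hence one witness per point. *)
Lemma smooth_on_near U f : 
  (forall x, U x -> exists2 g, (\forall y \near x, f y = g y) &
     forall k, Ck k [set x] g) -> smooth_on U f.
Proof.
move=> H k; apply: Ck_pointwise => x Ux; have [g fg gk] := H x Ux.
by apply: Ck_near (gk k); apply: filterS fg.
Qed.

Lemma smooth_onT U f : smooth_on setT f -> smooth_on U f.
Proof. by move=> fs k; apply: Ck_sub (fs k). Qed.

Lemma CkT_partial k f : (forall a x, derivable f x (delta_mx 0 a)) -> continuous f ->
  (forall a, Ck k setT (partial a f)) -> Ck k.+1 setT f.
Proof. by move=> df cf pf; split=> [x _|a]; [exact: cf|split]. Qed.

Lemma Ck_mono k U f : Ck k.+1 U f -> Ck k U f.
Proof.
elim: k f => [|k IH] f /=; first by case.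
by case=> fc fd; split=> // a; have [fa /IH] := fd a.
Qed.

Lemma partial_addc a f (c : R) : partial a (fun x => f x + c) = partial a f.
Proof.
apply/funext => x; rewrite /partial /derive.
set g1 := fun h => _; set g2 := fun h => h^-1 *: (_ - f x).
suff -> : g1 = g2 by [].
by apply/funext => h; rewrite /g1 /g2 /= opprD addrACA subrr addr0.
Qed.

Lemma Ck_addc k U f (c : R) : Ck k U f -> Ck k U (fun x => f x + c).
Proof.
case: k => [|k] /= [fc fd].
  by split=> // x Ux; exact: (cvgD (fc x Ux) (cvg_cst _)).
split=> [x Ux|a]; first exact: (cvgD (fc x Ux) (cvg_cst _)).
have [fa fk] := fd a; split; last by rewrite partial_addc.
by move=> x /fa ?; exact: derivableD.
Qed.

Lemma Ck_cst k U (c : R) : Ck k U (fun=> c).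
Proof.
elim: k c => [|k IH] c /=; split=> //; try by move=> x _; exact: cst_continuous.
move=> a; split=> [x _|]; first exact: derivable_cst.
rewrite (_ : partial a _ = fun=> 0); first exact: IH.
by apply/funext => x; exact: derive_cst.
Qed.

Lemma Ck_add k f g : Ck k setT f -> Ck k setT g -> Ck k setT (fun x => f x + g x).
Proof.
elim: k f g => [|k IH] f g /= [fc fd] [gc gd].
  by split=> // x _; exact: (cvgD (fc x I) (gc x I)).
split=> [x _|a]; first exact: (cvgD (fc x I) (gc x I)).
have [fa fk] := fd a; have [ga gk] := gd a.
split=> [x _|]; first by apply: derivableD; [exact: fa|exact: ga].
rewrite (_ : partial a _ = fun x => partial a f x + partial a g x); first exact: IH.
by apply/funext => x; apply: deriveD; [exact: fa|exact: ga].
Qed.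

Lemma Ck_mul k f g : Ck k setT f -> Ck k setT g -> Ck k setT (fun x => f x * g x).
Proof.
elim: k f g => [|k IH] f g.
  move=> [fc _] [gc _]; split=> // x _.
  exact: (cvgM (fc x I) (gc x I)).
(* The product rule pairs each partial derivative with an undifferentiated factor, which the
   induction hypothesis wants at order [k]. *)
move=> Cf Cg; have Cf' := Ck_mono Cf; have Cg' := Ck_mono Cg.
case: Cf => fc fd; case: Cg => gc gd.
split=> [x _|a]; first exact: (cvgM (fc x I) (gc x I)).
have [fa fk] := fd a; have [ga gk] := gd a.
split=> [x _|]; first by apply: derivableM; [exact: fa|exact: ga].
rewrite (_ : partial a _ = fun x => f x * partial a g x + g x * partial a f x).
  by apply: Ck_add; apply: IH.
by apply/funext => x; apply: deriveM; [exact: fa|exact: ga].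
Qed.

Lemma is_derive_comp_coord (phi : R -> R) (d : R) b x a :
  is_derive (x 0 b) 1 phi d ->
  is_derive x (delta_mx 0 a) (fun y => phi (y 0 b)) (d * (a == b)%:R).
Proof.
move=> phid; apply: derive_line.
rewrite (_ : (fun h : R => _) = phi \o (fun h : R => h * (a == b)%:R + x 0 b)); last first.
  by apply/funext => h /=; rewrite !mxE/= eq_sym.
set aff := fun h : R => _.
have affd : is_derive (0:R) 1 aff (a == b)%:R.
  rewrite /aff; apply: is_derive_eq; rewrite addr0 /=.
  by rewrite scaler0 add0r /GRing.scale /= mulr1.
apply: is_derive1_comp => //=.
by rewrite /aff mul0r add0r.
Qed.

Lemma partial_comp_coord (phi dphi : R -> R) a b :
  (forall t : R, is_derive t 1 phi (dphi t)) ->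
  partial a (fun y => phi (y 0 b)) = fun y => dphi (y 0 b) * (a == b)%:R.
Proof.
by move=> H; apply/funext => x; case: (is_derive_comp_coord a (H (x 0 b))).
Qed.

Lemma partial_coord a b : partial a (fun y : 'rV[R]_n => y 0 b) = fun=> (a == b)%:R.
Proof.
have := @partial_comp_coord id (fun=> 1) a b (fun t => is_derive_id t (1 : R)).
by move=> /= ->; apply/funext => y; rewrite mul1r.
Qed.

Lemma Ck_coord k b : Ck k setT (fun y : 'rV[R]_n => y 0 b).
Proof.
case: k => [|k]; first by split=> // x _; exact: coord_continuous.
apply: CkT_partial => [a x||a]; last by rewrite partial_coord; exact: Ck_cst.
  by case: (is_derive_comp_coord a (is_derive_id (x 0 b) (1 : R))).
exact: coord_continuous.
Qed.

Lemma Ck_sin_cos k b :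
  Ck k setT (fun y : 'rV[R]_n => sin (y 0 b)) /\ Ck k setT (fun y : 'rV[R]_n => cos (y 0 b)).
Proof.
have cc (phi : R -> R) : continuous phi -> continuous (fun y : 'rV[R]_n => phi (y 0 b)).
  move=> phic y; apply: (@continuous_comp _ _ _ (fun y : 'rV[R]_n => y 0 b) phi).
    exact: coord_continuous.
  exact: phic.
elim: k => [|k [IHs IHc]].
  by split; split=> // x _; apply: cc; [exact: continuous_sin|exact: continuous_cos].
split; apply: CkT_partial => [a x||a].
- by case: (is_derive_comp_coord a (is_derive_sin (x 0 b))).
- exact: cc (@continuous_sin R).
- rewrite (partial_comp_coord a b (@is_derive_sin R)).
  by apply: Ck_mul => //; exact: Ck_cst.
- by case: (is_derive_comp_coord a (is_derive_cos (x 0 b))).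
- exact: cc (@continuous_cos R).
- rewrite (partial_comp_coord a b (@is_derive_cos R)).
  apply: Ck_mul; last exact: Ck_cst.
  rewrite (_ : (fun y => - _) = fun y : 'rV[R]_n => -1 * sin (y 0 b)).
    by apply: Ck_mul => //; exact: Ck_cst.
  by apply/funext => y; rewrite mulN1r.
Qed.

End PartialDerivatives.

(** * Flat tori *)

Section Lattice.
Context {R : realType} {d : nat}.

Definition period : R := pi *+ 2.

Lemma period_gt0 : 0 < period.
Proof. by rewrite /period pmulrn_lgt0// pi_gt0. Qed.

Lemma reduce_period (c v : R) : exists k : int, c <= v + period *~ k < c + period.
Proof.
have T0 := period_gt0; pose x := (v - c) / period.
exists (- Num.floor x).
have -> : v + period *~ - Num.floor x = c + (x - (Num.floor x)%:~R) * period.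
  rewrite mulrBl /x divfK ?gt_eqF// mulrNz -mulrzl; ring.
have /andP[x1 x2] := floor_itv x.
rewrite lerDl ltrD2l pmulr_lge0// subr_ge0 x1 /=.
by rewrite gtr_pMl// ltrBlDl -intrD1.
Qed.

Lemma periodZ_lt (k : int) : `|period *~ k| < period -> k = 0.
Proof.
have T0 := period_gt0.
rewrite -mulrzl normrM (gtr0_norm T0) gtr_pMl// -intr_norm.
by rewrite -[X in _ < X]/(1%:~R) ltr_int; case: k => [[|k]|k].
Qed.

Definition lattice_vector (k : 'I_d -> int) : 'rV[R]_d := \row_j (period *~ k j).

Definition lattice_rel : rel 'rV[R]_d :=
  fun v w => `[< exists k, w = v + lattice_vector k >].

Lemma lattice_rel_refl : reflexive lattice_rel.
Proof.
by move=> v; apply/asboolP; exists (fun=> 0); apply/rowP => j; rewrite !mxE addr0.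
Qed.

Lemma lattice_rel_sym : symmetric lattice_rel.
Proof.
suff H v w : lattice_rel v w -> lattice_rel w v by move=> v w; apply/idP/idP; exact: H.
move=> /asboolP[k ->]; apply/asboolP; exists (fun j => - k j).
by apply/rowP => j; rewrite !mxE mulrNz addrK.
Qed.

Lemma lattice_rel_trans : transitive lattice_rel.
Proof.
move=> w v u /asboolP[k ->] /asboolP[l ->]; apply/asboolP; exists (fun j => k j + l j).
by apply/rowP => j; rewrite !mxE mulrzDr addrA.
Qed.

Canonical lattice_equiv :=
  EquivRel lattice_rel lattice_rel_refl lattice_rel_sym lattice_rel_trans.

End Lattice.

Definition torus (R : realType) (d : nat) :=
  quotient_topology {eq_quot (@lattice_equiv R d)}%qT.
HB.instance Definition _ R d := Topological.on (torus R d).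
HB.instance Definition _ R d := Quotient.on (torus R d).

Section Torus.
Context {R : realType} {d : nat}.
Implicit Types (v w : 'rV[R]_d) (p : torus R d).

Definition torus_pi : 'rV[R]_d -> torus R d := \pi_(torus R d)%qT.

Lemma torus_piP v w : torus_pi v = torus_pi w <-> exists k, w = v + lattice_vector k.
Proof.
split=> vw.
  by apply/asboolP; exact: (introT (@eqmodP _ (@lattice_equiv R d) v w) vw).
by apply: (elimT (@eqmodP _ (@lattice_equiv R d) v w)); exact/asboolP.
Qed.

Lemma torus_pi_lattice v k : torus_pi (v + lattice_vector k) = torus_pi v.
Proof. by apply/esym/torus_piP; exists k. Qed.

Lemma torus_pi_repr p : torus_pi (repr p) = p.
Proof. exact: reprK. Qed.

Lemma torus_pi_continuous : continuous torus_pi.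
Proof. exact: pi_continuous. Qed.

(** The preimage of the image is the union of the lattice translates of [U]. *)
Lemma open_torus_pi (U : set 'rV[R]_d) : open U -> open (torus_pi @` U).
Proof.
move=> oU; change (open (torus_pi @^-1` (torus_pi @` U))).
rewrite openE => v [u Uu /torus_piP[k ->]].
have /= : (fun w => w - lattice_vector k) w @[w --> u + lattice_vector k] --> u.
  rewrite -[X in _ --> X](addrK (lattice_vector k)).
  exact: (cvgB (@cvg_id _ (nbhs _)) (cvg_cst _)).
move=> /(_ U (open_nbhs_nbhs (conj oU Uu))) H.
have {}H : nbhs (u + lattice_vector k) [set w | U (w - lattice_vector k)] by exact: H.
change (nbhs (u + lattice_vector k) (torus_pi @^-1` (torus_pi @` U))).
apply: filterS H => w Uw; exists (w - lattice_vector k) => //.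
by rewrite -[in RHS](subrK (lattice_vector k) w) torus_pi_lattice.
Qed.

Lemma torus_pi_nbhs v (A : set 'rV[R]_d) : nbhs v A -> nbhs (torus_pi v) (torus_pi @` A).
Proof.
rewrite nbhsE => -[U [oU Uv] UA].
apply: (filterS (P := torus_pi @` U)); first exact: image_subset.
by apply: open_nbhs_nbhs; split; [exact: open_torus_pi|exists v].
Qed.

Lemma torus_hausdorff : hausdorff_space (torus R d).
Proof.
move=> p q; rewrite -(torus_pi_repr p) -(torus_pi_repr q).
move: (repr p) (repr q) => v w clvw; apply: contrapT => vw.
have T0 := @period_gt0 R.
have [j nj] : exists j, forall k : int, w 0 j != v 0 j + period *~ k.
  apply: contrapT => /forallNP H; apply: vw; apply/torus_piP.
  have /choice[k kP] : forall j, exists k : int, w 0 j = v 0 j + period *~ k.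
    move=> j; apply: contrapT => /forallNP Hj; apply: (H j) => k.
    by apply/eqP; exact: Hj.
  by exists k; apply/rowP => j; rewrite !mxE kP.
have [m /andP[m1 m2]] := reduce_period 0 (w 0 j - v 0 j).
set r := _ + _ in m1 m2; rewrite add0r in m2.
have r0 : 0 < r.
  rewrite lt_neqAle m1 andbT eq_sym; apply/eqP => rE.
  move: (nj (- m)); rewrite mulrNz => /eqP; apply.
  by apply/eqP; rewrite -subr_eq0 opprB addrCA addrC -addrA -/r; apply/eqP; rewrite -rE /r; ring.
(* [2 * e] is the distance of the two coordinates on the circle of length [period], so the bands of
   half-width [e] around them stay disjoint after any lattice translation. *)
pose e := Num.min r (period - r) / 2.
have e0 : 0 < e by rewrite divr_gt0// lt_min r0 subr_gt0.
have near_j (u : 'rV[R]_d) : nbhs u [set u' | `|u 0 j - u' 0 j| < e].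
  have := @coord_continuous R 1 d 0 j u.
  by move=> /cvgrPdist_lt /(_ e e0).
have [_ [[v' v'j <-] [w' w'j /torus_piP[k kE]]]] := clvw _ _ (torus_pi_nbhs (near_j v)) (torus_pi_nbhs (near_j w)).
have kEj : v' 0 j = w' 0 j + period *~ k j by rewrite kE !mxE.
move: v'j w'j; rewrite /= kEj !ltr_distl => v'j w'j.
have er : 2 * e <= r by rewrite /e mulrC divfK// ge_min lexx.
have eT : 2 * e <= period - r by rewrite /e mulrC divfK// ge_min lexx orbT.
have rk : period *~ (m - k j) - e - e < r < period *~ (m - k j) + e + e.
  rewrite /r mulrzBr; apply/andP; split; lra.
have /andP[rk1 rk2] := rk.
have : `|@period R *~ (m - k j)| < @period R by rewrite ltr_norml; apply/andP; split; lra.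
by move=> /periodZ_lt mk; move: rk2; rewrite mk mulr0z; lra.
Qed.

Lemma torus_compact : compact [set: torus R d].
Proof.
have -> : [set: torus R d] =
    torus_pi @` [set v : 'rV[R]_d | forall j, `[0, period]%classic (v ord0 j)].
  apply/seteqP; split=> // p _.
  have /choice[k kP] : forall j, exists k : int, 0 <= repr p 0 j + period *~ k < 0 + period.
    by move=> j; exact: reduce_period.
  exists (repr p + lattice_vector k); last by rewrite torus_pi_lattice torus_pi_repr.
  move=> j /=; rewrite !mxE in_itv /=; have /andP[-> /ltW] := kP j.
  by rewrite add0r => ->.
apply: continuous_compact; first exact: continuous_subspaceT torus_pi_continuous.
exact: (@rV_compact R d (fun=> `[0, period]%classic) (fun=> @segment_compact _ _ _)).
Qed.

(* The boxes have corners in {0, pi}^d; the indices i >= 2^d all give the box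
   with corner 0. *)
Definition corner (i : nat) (j : 'I_d) : R :=
  pi * (nth [ffun=> false] (enum {ffun 'I_d -> bool}) i j)%:R.

Definition box (i : nat) : set 'rV[R]_d :=
  [set v | forall j, corner i j < v 0 j < corner i j + period].

Definition chart (i : nat) (p : torus R d) : 'rV[R]_d :=
  xget 0 [set v | box i v /\ torus_pi v = p].

Lemma open_box i : open (box i).
Proof.
rewrite openE => v bv; change (nbhs v (box i)).
have H j : \forall w \near v, corner i j < (w : 'rV[R]_d) 0 j < corner i j + period.
  have /andP[cv vc] := bv j.
  have cj : (fun w : 'rV[R]_d => w 0 j) w @[w --> v] --> v 0 j by exact: coord_continuous.
  have H1 := cj _ (lt_nbhsr cv); have H2 := cj _ (lt_nbhsl vc).
  by near=> w; apply/andP; split; near: w; [exact: H1|exact: H2].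
exact: (@filter_forall _ _ _ _ _ H).
Unshelve. all: by end_near. Qed.

Lemma box_inj i v w : box i v -> box i w -> torus_pi v = torus_pi w -> v = w.
Proof.
move=> bv bw /torus_piP[k wE]; rewrite wE (_ : lattice_vector k = 0) ?addr0//.
apply/rowP => j; rewrite !mxE (_ : k j = 0) ?mulr0z//.
apply: (@periodZ_lt R).
have := bw j; rewrite wE !mxE; have := bv j.
move: (period *~ k j) => x /andP[? ?] /andP[? ?].
by rewrite ltr_norml; apply/andP; split; lra.
Qed.

Lemma chartK i v : box i v -> chart i (torus_pi v) = v.
Proof.
move=> bv; rewrite /chart; case: xgetP => [w _ [bw wv]|/(_ v)[]//].
exact: box_inj bw bv wv.
Qed.

Lemma chart_dom i p : (torus_pi @` box i) p -> box i (chart i p) /\ torus_pi (chart i p) = p.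
Proof. by move=> [v bv <-]; rewrite chartK. Qed.

Lemma chart_cod i : chart i @` (torus_pi @` box i) = box i.
Proof.
apply/seteqP; split=> [_ [_ [v bv <-] <-]|v bv]; first by rewrite chartK.
by exists (torus_pi v); [exists v|rewrite chartK].
Qed.

(** The bound on [i] matters for the area: it leaves only finitely many nonempty fresh pieces. *)
Lemma box_cover p : exists2 i, (i < #|{ffun 'I_d -> bool}|)%N & (torus_pi @` box i) p.
Proof.
have T0 := @period_gt0 R; have p0 := @pi_gt0 R.
have /choice[f fP] : forall j, exists bk : bool * int,
    pi * bk.1%:R < repr p 0 j + period *~ bk.2 < pi * bk.1%:R + period.
  move=> j; have [k /andP[]] := reduce_period 0 (repr p 0 j).
  (* A coordinate reduced to exactly [0] misses the open interval [(0, 2 pi)]; one more period puts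
     it at [2 pi], inside [(pi, 3 pi)]. *)
  rewrite le_eqVlt add0r => /predU1P[kE _|k1 k2].
    exists (true, k + 1); rewrite /= mulrzDr addrA -kE mulr1z mulr1 /period mulr2n.
    by apply/andP; split; lra.
  by exists (false, k); rewrite /= mulr0 add0r k1.
pose b := [ffun j => (f j).1].
exists (index b (enum {ffun 'I_d -> bool})).
  by rewrite cardE index_mem mem_enum.
exists (repr p + lattice_vector (fun j => (f j).2)); last by rewrite torus_pi_lattice torus_pi_repr.
by move=> j; rewrite !mxE /corner nth_index ?mem_enum// ffunE; exact: fP.
Qed.

Lemma chart_continuous i p : (torus_pi @` box i) p -> {for p, continuous (chart i)}.
Proof.
move=> [v bv <-] A; rewrite chartK// => Av.
have : nbhs v (A `&` box i).
  by apply: filterI => //; apply: open_nbhs_nbhs; split => //; exact: open_box.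
move=> /torus_pi_nbhs; apply: filterS => _ [w [Aw bw] <-].
by rewrite /= chartK.
Qed.

(** Every chart inverts the covering map up to a lattice vector that is locally constant. All chart
    computations below reduce to this, so Jacobians of chart changes are identities and periodic
    data descend to the torus. *)
Lemma chart_near i v (w : 'rV[R]_d) : box i w -> torus_pi v = torus_pi w ->
  exists k, w = v + lattice_vector k /\
    \forall v' \near v, box i (v' + lattice_vector k) /\
       chart i (torus_pi v') = v' + lattice_vector k.
Proof.
move=> bw /torus_piP[k wE]; exists k; split=> //.
have /= H : (fun w => w + lattice_vector k) v' @[v' --> v] --> w.
  rewrite wE; exact: (cvgD (@cvg_id _ (nbhs _)) (cvg_cst _)).
have {}H := H _ (open_nbhs_nbhs (conj (@open_box i) bw)).
have {}H : nbhs v [set v' | box i (v' + lattice_vector k)] by exact: H.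
by apply: filterS H => v' bv'; split=> //; rewrite -(torus_pi_lattice v' k) chartK.
Qed.

Lemma torus_transition_smooth i j (b : 'I_d) :
  smooth_on (chart i @` ((torus_pi @` box i) `&` (torus_pi @` box j)))
    (fun x => chart j (torus_pi x) 0 b).
Proof.
apply: smooth_on_near => _ [p [[v bv <-] [w bw wv]] <-]; rewrite chartK//.
have [k [_ H]] := chart_near bw (esym wv).
exists (fun x => x 0 b + lattice_vector k 0 b).
  by apply: filterS H => x [_ ->]; rewrite mxE.
by move=> m; apply: Ck_addc; apply: Ck_sub (Ck_coord m b).
Qed.

Definition torus_manifold : manifold R d.
refine (@Manifold R d (torus R d) (fun i => torus_pi @` box i) chart (fun=> torus_pi)
  torus_hausdorff _ _ _ _ _ _ _).
- by move=> p; have [i _ ?] := box_cover p; exists i.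
- by move=> i; exact/open_torus_pi/open_box.
- by move=> i; rewrite chart_cod; exact: open_box.
- by move=> i p /chart_dom[].
- exact: chart_continuous.
- by move=> i x _; exact: torus_pi_continuous.
- exact: torus_transition_smooth.
Defined.

Lemma torus_cod i : cod torus_manifold i = box i.
Proof. exact: chart_cod. Qed.

End Torus.

(** * Curvature of a torus bundle with turning fibre metric *)

(** Coordinates from index 4 on are flat. Tensors are written as tables indexed by [nat], so that
    contractions collapse to four terms for every [m] and case analysis on the indices computes. *)
Definition sum4 (V : nmodType) (F : nat -> V) : V := F 0%N + F 1%N + F 2%N + F 3%N.

Lemma sum_ord4 (V : nmodType) (m : nat) (F : nat -> V) :
  (forall k, F k.+4 = 0) -> \sum_(l < m.+4) F l = sum4 F.
Proof.
move=> F0; rewrite !big_ord_recl big1 ?addr0 ?addrA//.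
by move=> i _; rewrite /= /bump /= !add1n F0.
Qed.

Section Curvature.
Context {R : realType} {m : nat} (alpha alpha1 alpha2 beta beta1 beta2 : R -> R).
Hypothesis dalpha : forall t : R, is_derive t 1 alpha (alpha1 t).
Hypothesis dalpha1 : forall t : R, is_derive t 1 alpha1 (alpha2 t).
Hypothesis dbeta : forall t : R, is_derive t 1 beta (beta1 t).
Hypothesis dbeta1 : forall t : R, is_derive t 1 beta1 (beta2 t).
Hypothesis det_neq0 : forall t, alpha t ^+ 2 - beta t ^+ 2 != 0.

Definition tcoord : 'I_m.+4 := ord0.
Definition xcoord : 'I_m.+4 := @Ordinal m.+4 3 isT.

(* Coordinates: 0 is t, 1 and 2 are the fibre coordinates y and z, 3 is x. *)
Definition metric_entry (a b : nat) (t x : R) : R :=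
  match a, b with
  | 1%N, 1%N => alpha t + beta t * cos x
  | 1%N, 2%N | 2%N, 1%N => beta t * sin x
  | 2%N, 2%N => alpha t - beta t * cos x
  | _, _ => (a == b)%:R
  end.

Definition warped_gram (v : 'rV[R]_m.+4) : 'M[R]_m.+4 :=
  \matrix_(a, b) metric_entry a b (v 0 tcoord) (v 0 xcoord).

Definition inv_entry (a b : nat) (t x : R) : R :=
  match a, b with
  | 1%N, 1%N => (alpha t - beta t * cos x) / (alpha t ^+ 2 - beta t ^+ 2)
  | 1%N, 2%N | 2%N, 1%N => - (beta t * sin x) / (alpha t ^+ 2 - beta t ^+ 2)
  | 2%N, 2%N => (alpha t + beta t * cos x) / (alpha t ^+ 2 - beta t ^+ 2)
  | _, _ => (a == b)%:R
  end.

Lemma nat_cases4 (P : nat -> Prop) :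
  P 0%N -> P 1%N -> P 2%N -> P 3%N -> (forall k, P k.+4) -> forall n, P n.
Proof. by move=> ? ? ? ? ?; do 4?case=> //. Qed.

Lemma metric_entry_ge4 a b t x : (4 <= a)%N -> metric_entry a b t x = (a == b)%:R.
Proof. by case: a => [|[|[|[|a]]]]. Qed.

Lemma inv_entry_ge4 a b t x : (4 <= a)%N -> inv_entry a b t x = (a == b)%:R.
Proof. by case: a => [|[|[|[|a]]]]. Qed.

Lemma invmx_warped_gram v : invmx (warped_gram v) = \matrix_(a, b) inv_entry a b (v 0 tcoord) (v 0 xcoord).
Proof.
set B := \matrix_(a, b) _.
have BG : B *m warped_gram v = 1%:M.
  apply/matrixP => a b; rewrite !mxE.
  under eq_bigr do rewrite !mxE.
  move: (v 0 tcoord) (v 0 xcoord) => t x.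
  have V0 := det_neq0 t; have s2 := sin2cos2 x.
  have [a4|a4] := leqP 4 a.
    rewrite (bigD1 a)//= big1 ?addr0 => [|l la].
      by rewrite inv_entry_ge4// metric_entry_ge4// eqxx mul1r.
    by rewrite inv_entry_ge4// eq_sym (inj_eq val_inj) (negPf la) mul0r.
  rewrite (@sum_ord4 _ _ (fun l => inv_entry a l t x * metric_entry l b t x)) /sum4 => [|k].
    rewrite -val_eqE /=; move: (nat_of_ord a) a4 (nat_of_ord b).
    elim/nat_cases4 => [||||ka]// _; elim/nat_cases4 => [||||kb];
      rewrite /= ?eqxx; by [field: s2|ring].
  by move: (nat_of_ord a) a4; elim/nat_cases4 => [||||ka]// _; rewrite /= mul0r.
have Gu : warped_gram v \in unitmx by case: (mulmx1_unit BG).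
by rewrite -[RHS]mulmx1 -(mulmxV Gu) mulmxA BG mul1mx.
Qed.

Lemma partial_tx (F : R -> R -> R) (c : 'I_m.+4) (v : 'rV[R]_m.+4) :
  partial c (fun v => F (v 0 tcoord) (v 0 xcoord)) v =
  match val c with
  | 0%N => 'D_1 (F^~ (v 0 xcoord)) (v 0 tcoord)
  | 3%N => 'D_1 (F (v 0 tcoord)) (v 0 xcoord)
  | _ => 0
  end.
Proof.
rewrite /partial; set f := fun v => F _ _.
have cst (e : 'rV[R]_m.+4) : e 0 tcoord = 0 -> e 0 xcoord = 0 -> 'D_e f v = 0.
  move=> e0 e3; have fe : (fun h : R => f (h *: e + v)) = cst (f v).
    by apply/funext => h; rewrite /f !mxE e0 e3 !mulr0 !add0r.
  have H : is_derive (0 : R) 1 (fun h : R => f (h *: e + v)) 0 by rewrite fe; exact: is_derive_cst.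
  by case: (derive_line H).
case: c => -[|[|[|[|k]]]] ck /=; try by apply: cst; rewrite mxE.
- rewrite /derive /f; set g1 := fun h => _; set g2 := fun h => h^-1 *: (_ - F _ _).
  suff -> : g1 = g2 by [].
  by apply/funext => h; rewrite /g1 /g2 /= !mxE /= mulr0 mulr1 add0r [_%:A]mulr1.
- rewrite /derive /f; set g1 := fun h => _; set g2 := fun h => h^-1 *: (_ - F _ _).
  suff -> : g1 = g2 by [].
  by apply/funext => h; rewrite /g1 /g2 /= !mxE /= mulr0 mulr1 add0r [_%:A]mulr1.
Qed.

Definition dmetric_entry (c a b : nat) (t x : R) : R :=
  match c, a, b with
  | 0%N, 1%N, 1%N => alpha1 t + beta1 t * cos x
  | 0%N, 1%N, 2%N | 0%N, 2%N, 1%N => beta1 t * sin x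
  | 0%N, 2%N, 2%N => alpha1 t - beta1 t * cos x
  | 3%N, 1%N, 1%N => - (beta t * sin x)
  | 3%N, 1%N, 2%N | 3%N, 2%N, 1%N => beta t * cos x
  | 3%N, 2%N, 2%N => beta t * sin x
  | _, _, _ => 0
  end.

Lemma partial_warped_gram (a b c : 'I_m.+4) v :
  partial c (fun v => warped_gram v a b) v = dmetric_entry c a b (v 0 tcoord) (v 0 xcoord).
Proof.
rewrite (_ : (fun v => _) = fun v : 'rV[R]_m.+4 => metric_entry a b (v 0 tcoord) (v 0 xcoord)); last first.
  by apply/funext => w; rewrite mxE.
rewrite partial_tx /=; move: (v 0 tcoord) (v 0 xcoord) (nat_of_ord a) (nat_of_ord b) => t x.
move: (nat_of_ord c); elim/nat_cases4 => [||||kc]; elim/nat_cases4 => [||||ka];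
  elim/nat_cases4 => [||||kb] //=; rewrite ?derive_cst//.
all: apply: derive_val.
all: apply: is_derive_eq.
all: rewrite /GRing.scale /=.
all: by ring.
Qed.

Definition fibre_det (t : R) : R := alpha t ^+ 2 - beta t ^+ 2.

(** In terms of the eigenvalues [alpha + beta] and [alpha - beta], [dlogvol] (the [l] of the
    overview) and [shear] are half the sum and half the difference of their logarithmic
    derivatives. *)
Definition dlogvol t := (alpha t * alpha1 t - beta t * beta1 t) / (alpha t ^+ 2 - beta t ^+ 2).
Definition shear t := (alpha t * beta1 t - beta t * alpha1 t) / (alpha t ^+ 2 - beta t ^+ 2).
Definition rho t := beta t / (2 * (alpha t ^+ 2 - beta t ^+ 2)).

(* The fibre block h^-1 d_t h / 2, that is the symbols Gamma^i_(t j). *)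
Definition Gamma_t (i j : nat) (t x : R) : R :=
  match i, j with
  | 1%N, 1%N => 2^-1 * (dlogvol t + shear t * cos x)
  | 1%N, 2%N | 2%N, 1%N => 2^-1 * (shear t * sin x)
  | 2%N, 2%N => 2^-1 * (dlogvol t - shear t * cos x)
  | _, _ => 0
  end.

(* The fibre block h^-1 d_x h / 2, that is the symbols Gamma^i_(x j). *)
Definition Gamma_x (i j : nat) (t x : R) : R :=
  match i, j with
  | 1%N, 1%N => - (alpha t * sin x) * rho t
  | 1%N, 2%N => (alpha t * cos x - beta t) * rho t
  | 2%N, 1%N => (alpha t * cos x + beta t) * rho t
  | 2%N, 2%N => alpha t * sin x * rho t
  | _, _ => 0
  end.

(** The directions [t] and [x] are unit and orthogonal to the fibre: an upper index [t] or [x] gives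
    minus half a derivative of [h], and an upper fibre index needs one fibre and one base index
    below. *)
Definition Gamma (k a b : nat) (t x : R) : R :=
  match k with
  | 0%N => - 2^-1 * dmetric_entry 0 a b t x
  | 3%N => - 2^-1 * dmetric_entry 3 a b t x
  | 1%N | 2%N =>
    match a, b with
    | 0%N, _ => Gamma_t k b t x
    | _, 0%N => Gamma_t k a t x
    | 3%N, _ => Gamma_x k b t x
    | _, 3%N => Gamma_x k a t x
    | _, _ => 0
    end
  | _ => 0
  end.

Lemma Gamma_entries (k a b : nat) t x :
  2^-1 * (\sum_(j < m.+4) inv_entry k j t x * (dmetric_entry a j b t x + dmetric_entry b j a t x - dmetric_entry j a b t x))
  = Gamma k a b t x.
Proof.
rewrite (@sum_ord4 _ _ (fun j => inv_entry k j t x * (dmetric_entry a j b t x + dmetric_entry b j a t x - dmetric_entry j a b t x))); last first.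
  move=> j; suff -> : dmetric_entry a j.+4 b t x + dmetric_entry b j.+4 a t x - dmetric_entry j.+4 a b t x = 0 by rewrite mulr0.
  by elim/nat_cases4: a => [||||a]; elim/nat_cases4: b => [||||b]; rewrite /= subr0 addr0.
have V0 := det_neq0 t; have s2 := sin2cos2 x.
elim/nat_cases4: k => [||||k]; elim/nat_cases4: a => [||||a];
  elim/nat_cases4: b => [||||b]; rewrite /sum4 /= /dlogvol /shear /rho /=; by [ring|field: s2].
Qed.

Lemma christoffel_warped_gram (k a b : 'I_m.+4) :
  christoffel warped_gram k a b = fun v => Gamma k a b (v 0 tcoord) (v 0 xcoord).
Proof.
apply/funext => v; rewrite /christoffel invmx_warped_gram -Gamma_entries.
by congr (_ * _); apply: eq_bigr => j _; rewrite !partial_warped_gram mxE.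
Qed.

Definition dGamma (c k a b : nat) (t x : R) : R :=
  match c with
  | 0%N => 'D_1 ((Gamma k a b)^~ x) t
  | 3%N => 'D_1 (Gamma k a b t) x
  | _ => 0
  end.

Definition ric (b d : nat) (t x : R) : R :=
  sum4 (fun a => dGamma a a d b t x - dGamma d a a b t x
    + sum4 (fun e => Gamma a a e t x * Gamma e d b t x - Gamma a d e t x * Gamma e a b t x)).

Lemma ricci_warped_gram (b d : 'I_m.+4) v :
  ricci warped_gram v b d = ric b d (v 0 tcoord) (v 0 xcoord).
Proof.
rewrite mxE /riemann.
under eq_bigr => a _.
  rewrite !christoffel_warped_gram !partial_tx.
  under eq_bigr do rewrite !christoffel_warped_gram.
  over.
move: (v 0 tcoord) (v 0 xcoord) => t x.
have chr4 k a c : Gamma k.+4 a c = fun=> fun=> 0 by [].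
pose F a := dGamma a a d b t x - dGamma d a a b t x
  + sum4 (fun e => Gamma a a e t x * Gamma e d b t x - Gamma a d e t x * Gamma e a b t x).
rewrite -[RHS]/(sum4 F) -(@sum_ord4 _ m F).
  apply: eq_bigr => a _; congr (_ + _).
  pose F' e := Gamma a a e t x * Gamma e d b t x - Gamma a d e t x * Gamma e a b t x.
  by rewrite -[RHS]/(sum4 F') -(@sum_ord4 _ m F')// => k; rewrite /F' !chr4 !mulr0 subr0.
move=> k; rewrite /F /dGamma /sum4 !chr4 !mul0r.
by elim/nat_cases4: (nat_of_ord d) => [||||j]; rewrite ?derive_cst !subrr !addr0.
Qed.

Definition d2logvol t := (alpha1 t ^+ 2 + alpha t * alpha2 t - beta1 t ^+ 2 - beta t * beta2 t) / fibre_det t - 2 * dlogvol t ^+ 2.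
Definition dshear t := (alpha t * beta2 t - beta t * alpha2 t) / fibre_det t - 2 * dlogvol t * shear t.

Instance is_derive_inv_fibre_det (t : R) : is_derive t 1 (fun t => (alpha t ^+ 2 - beta t ^+ 2)^-1)
  (- 2 * dlogvol t / fibre_det t).
Proof.
have V0 := det_neq0 t.
pose f t := alpha t ^+ 2 - beta t ^+ 2; have f0 : f t != 0 by [].
have [dv dvE] : is_derive t 1 f (2 * (alpha t * alpha1 t - beta t * beta1 t)).
  by apply: is_derive_eq; rewrite /GRing.scale /=; ring.
have := @deriveV _ _ f t 1 f0 dv; rewrite dvE => fE.
have df := @derivableV _ _ f t 1 f0 dv.
apply: DeriveDef; first exact: df.
rewrite [LHS]fE /GRing.scale /= /dlogvol /fibre_det /f.
by field.
Qed.

Lemma is_derive_dlogvol (t : R) : is_derive t 1 dlogvol (d2logvol t).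
Proof.
have V0 := det_neq0 t.
pose n t := alpha t * alpha1 t - beta t * beta1 t.
have dn : is_derive t 1 n (alpha1 t ^+ 2 + alpha t * alpha2 t - beta1 t ^+ 2 - beta t * beta2 t).
  by apply: is_derive_eq; rewrite /GRing.scale /=; ring.
have := is_deriveM dn (is_derive_inv_fibre_det t).
rewrite (_ : n * _ = dlogvol) //; move=> H; apply: is_derive_eq H _.
rewrite /GRing.scale /= /d2logvol /dlogvol /fibre_det /n.
by field.
Qed.

Lemma is_derive_shear (t : R) : is_derive t 1 shear (dshear t).
Proof.
have V0 := det_neq0 t.
pose n t := alpha t * beta1 t - beta t * alpha1 t.
have dn : is_derive t 1 n (alpha t * beta2 t - beta t * alpha2 t).
  by apply: is_derive_eq; rewrite /GRing.scale /=; ring.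
have := is_deriveM dn (is_derive_inv_fibre_det t).
rewrite (_ : n * _ = shear) //; move=> H; apply: is_derive_eq H _.
rewrite /GRing.scale /= /dshear /shear /dlogvol /fibre_det /n.
by field.
Qed.

Lemma dGamma_fibre (t x : R) :
  [/\ dGamma 0 0 1 1 t x = - 2^-1 * (alpha2 t + beta2 t * cos x),
      dGamma 0 0 1 2 t x = - 2^-1 * (beta2 t * sin x),
      dGamma 0 0 2 1 t x = - 2^-1 * (beta2 t * sin x)
    & dGamma 0 0 2 2 t x = - 2^-1 * (alpha2 t - beta2 t * cos x)] /\
  [/\ dGamma 3 3 1 1 t x = 2^-1 * (beta t * cos x),
      dGamma 3 3 1 2 t x = 2^-1 * (beta t * sin x),
      dGamma 3 3 2 1 t x = 2^-1 * (beta t * sin x)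
    & dGamma 3 3 2 2 t x = - 2^-1 * (beta t * cos x)].
Proof.
split; split; rewrite /dGamma /Gamma /dmetric_entry; apply: derive_val.
all: by apply: is_derive_eq; rewrite /GRing.scale /=; ring.
Qed.

Lemma dGamma_base (t x : R) :
  [/\ dGamma 0 1 1 0 t x = 2^-1 * (d2logvol t + dshear t * cos x),
      dGamma 0 2 2 0 t x = 2^-1 * (d2logvol t - dshear t * cos x),
      dGamma 3 1 1 3 t x = - (alpha t * cos x) * rho t
    & dGamma 3 2 2 3 t x = alpha t * cos x * rho t].
Proof.
have dlt := is_derive_dlogvol t; have dwt := is_derive_shear t.
split; rewrite /dGamma /Gamma /Gamma_t /Gamma_x; apply: derive_val.
all: by apply: is_derive_eq; rewrite /GRing.scale /=; ring.
Qed.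

Lemma dGamma_zero (t x : R) :
  [/\ dGamma 3 3 0 0 t x = 0, dGamma 0 3 3 0 t x = 0, dGamma 0 0 3 3 t x = 0 & dGamma 3 0 0 3 t x = 0].
Proof.
have E0 : Gamma 0 3 3 = fun=> fun=> 0 by do 2!apply/funext=> ?; rewrite /= mulr0.
have E1 : Gamma 3 0 0 = fun=> fun=> 0 by do 2!apply/funext=> ?; rewrite /= mulr0.
have E2 : Gamma 3 3 0 = fun=> fun=> 0 by do 2!apply/funext=> ?; rewrite /= mulr0.
have E3 : Gamma 0 0 3 = fun=> fun=> 0 by do 2!apply/funext=> ?; rewrite /= mulr0.
by rewrite /dGamma E0 E1 E2 E3 !derive_cst.
Qed.

(** The Riccati equation [Ric(d_t, d_t) = - (tr K)' - tr K^2] for [K = Gamma_t], whose eigenvalues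
    are [(l + shear) / 2] and [(l - shear) / 2]. *)
Lemma ric_tt t x : ric 0 0 t x = - d2logvol t - 2^-1 * (dlogvol t ^+ 2 + shear t ^+ 2).
Proof.
have s2 := sin2cos2 x.
rewrite /ric /sum4 /=.
have [/= -> -> _ _] := dGamma_base t x.
have [/= -> -> _ _] := dGamma_zero t x.
by field: s2.
Qed.

(** The same equation in the direction [x], with [K = Gamma_x] of trace zero and
    [tr K^2 = beta^2 / (2 det h)]: this is the cost of turning. *)
Lemma ric_xx t x : ric 3 3 t x = - beta t ^+ 2 / (2 * fibre_det t).
Proof.
have s2 := sin2cos2 x; have V0 := det_neq0 t.
rewrite /ric /sum4 /=.
have [/= _ _ -> ->] := dGamma_base t x.
have [/= _ _ -> ->] := dGamma_zero t x.
rewrite /rho /fibre_det; by field: s2.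
Qed.

(** Single entries depend on [x]; in the trace this cancels and [- v'' / v] remains, where [v] is
    the square root of [det h]. *)
Lemma ric_fibre t x :
  inv_entry 1 1 t x * ric 1 1 t x + inv_entry 1 2 t x * ric 1 2 t x +
  inv_entry 2 1 t x * ric 2 1 t x + inv_entry 2 2 t x * ric 2 2 t x = - d2logvol t - dlogvol t ^+ 2.
Proof.
have s2 := sin2cos2 x; have V0 := det_neq0 t.
have [/= [e1 e2 _ e4] [f1 f2 _ f4]] := dGamma_fibre t x.
rewrite /ric /sum4 /= e1 e2 e4 f1 f2 f4 /d2logvol /shear /dlogvol /rho /fibre_det.
by field: s2.
Qed.

Lemma ric_ge4 b d t x : ric b.+4 d t x = 0.
Proof.
have chr4 k a c : Gamma k a c.+4 = fun=> fun=> 0.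
  do 2!apply/funext=> ?; elim/nat_cases4: k => [||||k]; elim/nat_cases4: a => [||||a];
    by rewrite //= mulr0.
have dchr4 c k a e : dGamma c k a e.+4 t x = 0.
  by rewrite /dGamma chr4; elim/nat_cases4: c => [||||c]; rewrite ?derive_cst.
by rewrite /ric /sum4 !dchr4 !chr4 !mulr0 !subrr !addr0.
Qed.

Lemma scalar_curvature_warped_gram (v : 'rV[R]_m.+4) : let t := v 0 tcoord in
  scalar_curvature warped_gram v =
  - 2 * d2logvol t - 3 / 2 * dlogvol t ^+ 2 - 2^-1 * shear t ^+ 2 - beta t ^+ 2 / (2 * fibre_det t).
Proof.
rewrite /scalar_curvature invmx_warped_gram /=.
under eq_bigr do under eq_bigr do rewrite mxE ricci_warped_gram.
move: (v 0 tcoord) (v 0 xcoord) => t x.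
have inv4 b d : inv_entry b d.+4 t x * ric b d.+4 t x = 0.
  elim/nat_cases4: b => [||||b]; rewrite ?ric_ge4 ?mulr0//= ?mul0r//.
rewrite (@sum_ord4 _ _ (fun b => \sum_(d < m.+4) inv_entry b d t x * ric b d t x)); last first.
  by move=> b; rewrite big1// => d _; rewrite ric_ge4 mulr0.
have inner b : \sum_(d < m.+4) inv_entry b d t x * ric b d t x = sum4 (fun d => inv_entry b d t x * ric b d t x).
  by rewrite -(@sum_ord4 _ m).
(* Adding zero as the fibre trace minus its value brings the fibre entries of [ric] to both sides,
   where they cancel as unknowns. *)
rewrite [LHS]/sum4 !inner /sum4 -[RHS]addr0 -(subrr (- d2logvol t - dlogvol t ^+ 2)) -{1}(ric_fibre t x) ric_tt ric_xx.
have V0 := det_neq0 t; rewrite /fibre_det.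
move: (inv_entry 1 1 t x) (inv_entry 1 2 t x) (inv_entry 2 1 t x) (inv_entry 2 2 t x) => m1 m2 m3 m4.
by rewrite /inv_entry /=; field.
Qed.

Lemma ricci_warped_gram_tt (v : 'rV[R]_m.+4) : let t := v 0 tcoord in
  ricci warped_gram v tcoord tcoord = - d2logvol t - 2^-1 * (dlogvol t ^+ 2 + shear t ^+ 2).
Proof. by rewrite ricci_warped_gram ric_tt. Qed.

End Curvature.

(** * The profile of the fibre metric *)

Section Profile.
Context {R : realType}.
Implicit Types t x : R.

(** The amplitude [c = 1 / 10] has to be small: near [t = 0] the decay of [beta^2] gains [c t^2 / 3]
    in scalar curvature, linear in [c], while [- 2 l'] and the shear cost [c^2 t^2] and
    [c^2 t^2 / 2]. *)
Definition osc t : R := (1 - cos t) / 10.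
Definition dosc t : R := sin t / 10.
Definition ddosc t : R := cos t / 10.
(* With q := osc (1 - osc) one has alpha = 2 - q and beta^2 = 1 - 4 q, whence
   alpha^2 - beta^2 = 3 + q^2: the determinant moves at order t^4 only, while
   beta^2 moves at order t^2. *)
Definition alpha t : R := 2 - osc t + osc t ^+ 2.
Definition alpha1 t : R := (2 * osc t - 1) * dosc t.
Definition alpha2 t : R := 2 * dosc t ^+ 2 + (2 * osc t - 1) * ddosc t.
Definition beta t : R := 1 - 2 * osc t.
Definition beta1 t : R := - 2 * dosc t.
Definition beta2 t : R := - 2 * ddosc t.

Lemma is_derive_osc t : is_derive t 1 osc (dosc t).
Proof. by apply: is_derive_eq; rewrite /GRing.scale /= /dosc; ring. Qed.

Lemma is_derive_dosc t : is_derive t 1 dosc (ddosc t).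
Proof. by apply: is_derive_eq; rewrite /GRing.scale /= /ddosc; ring. Qed.

Lemma is_derive_alpha t : is_derive t 1 alpha (alpha1 t).
Proof.
have d := is_derive_osc t.
by apply: is_derive_eq; rewrite /GRing.scale /= /alpha1; ring.
Qed.

Lemma is_derive_alpha1 t : is_derive t 1 alpha1 (alpha2 t).
Proof.
have d := is_derive_osc t; have d1 := is_derive_dosc t.
by apply: is_derive_eq; rewrite /GRing.scale /= /alpha2; ring.
Qed.

Lemma is_derive_beta t : is_derive t 1 beta (beta1 t).
Proof.
have d := is_derive_osc t.
by apply: is_derive_eq; rewrite /GRing.scale /= /beta1; ring.
Qed.

Lemma is_derive_beta1 t : is_derive t 1 beta1 (beta2 t).
Proof.
have d1 := is_derive_dosc t.
by apply: is_derive_eq; rewrite /GRing.scale /= /beta2; ring.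
Qed.

Lemma fibre_detE t : fibre_det alpha beta t = 3 + (osc t * (1 - osc t)) ^+ 2.
Proof. by rewrite /fibre_det /alpha /beta; ring. Qed.

Lemma fibre_det_ge3 t : 3 <= fibre_det alpha beta t.
Proof. by rewrite fibre_detE lerDl sqr_ge0. Qed.

Lemma fibre_det_neq0 t : alpha t ^+ 2 - beta t ^+ 2 != 0.
Proof. by rewrite gt_eqF// (lt_le_trans _ (fibre_det_ge3 t)). Qed.

Lemma osc_itv t : 0 <= osc t <= 5^-1.
Proof.
have := cos_le1 t; have := cos_geN1 t; rewrite /osc => ? ?; apply/andP; split; lra.
Qed.

(** With this and [ddoscE] the curvature bound becomes a polynomial inequality in [osc] on
    [[0, 1/5]]. *)
Lemma dosc_sqr t : dosc t ^+ 2 = osc t * (5^-1 - osc t).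
Proof. by rewrite /dosc /osc; have s2 := sin2cos2 t; field: s2. Qed.

Lemma ddoscE t : ddosc t = 10^-1 - osc t.
Proof. by rewrite /ddosc /osc; field. Qed.

Definition scal_profile t : R :=
  - 2 * d2logvol alpha alpha1 alpha2 beta beta1 beta2 t - 3 / 2 * dlogvol alpha alpha1 beta beta1 t ^+ 2
  - 2^-1 * shear alpha alpha1 beta beta1 t ^+ 2 - beta t ^+ 2 / (2 * fibre_det alpha beta t).

Lemma scal_profile_ge t : - 6^-1 <= scal_profile t.
Proof.
have /andP[y0 y1] := osc_itv t; have V3 := fibre_det_ge3 t; have Vn := fibre_det_neq0 t.
pose q := osc t * (1 - osc t).
pose q1 := (1 - 2 * osc t) * dosc t.
pose q2 := - 2 * dosc t ^+ 2 + (1 - 2 * osc t) * ddosc t.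
have VE := fibre_detE t; rewrite -/q in VE.
(* Here [q1], [q2] are the derivatives of [q] and [V = 3 + q^2] is the determinant. Then
   [l = q q1 / V] and [shear = - dosc (3 + 2 q) / V], the turning term gives [1/6 - beta^2 / (2 V) =
   (q^2 + 12 q) / (6 V)], and [5 / 2] is [4 - 3 / 2] because [l'] contains [- 2 l^2]. *)
have -> : scal_profile t = - 6^-1 + (((q ^+ 2 + 12 * q) / 6 - 2 * (q1 ^+ 2 + q * q2)) * fibre_det alpha beta t
   + 5 / 2 * q ^+ 2 * q1 ^+ 2 - 2^-1 * dosc t ^+ 2 * (3 + 2 * q) ^+ 2) / fibre_det alpha beta t ^+ 2.
  rewrite /scal_profile /d2logvol /dlogvol /shear /fibre_det.
  move: Vn; rewrite /q2 /q1 /q /alpha2 /alpha1 /beta2 /beta1 /alpha /beta.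
  by move: (osc t) (dosc t) (ddosc t) => y z z2 Vn; field.
rewrite lerDl divr_ge0 ?sqr_ge0//.
have := dosc_sqr t; have := ddoscE t; move: VE V3; rewrite /q2 /q1.
have qE : q = osc t * (1 - osc t) by [].
move: q (osc t) (dosc t) (ddosc t) (fibre_det alpha beta t) y0 y1 qE => q y z z2 W y0 y1 qE WE W3 z2E zE.
have q_ge : 4 / 5 * y <= q by rewrite qE; nra.
have q_le : q <= y by rewrite qE; nra.
have z0 : 0 <= z ^+ 2 by exact: sqr_ge0.
have z_le : z ^+ 2 <= 5^-1 * y by rewrite zE; nra.
have q1_le : ((1 - 2 * y) * z) ^+ 2 <= 5^-1 * y.
  by rewrite exprMn; apply: le_trans z_le; rewrite ler_piMl// expr_le1//; lra.
have qq2_le : q * (- 2 * z ^+ 2 + (1 - 2 * y) * z2) <= 10^-1 * y.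
  have : - 2 * z ^+ 2 + (1 - 2 * y) * z2 <= 10^-1 by rewrite z2E; nra.
  by move: (- 2 * z ^+ 2 + (1 - 2 * y) * z2) => u u1; nra.
(* The turning term gains at least [2 q >= 8/5 y], and the terms in [q1], [q2] cost at most
   [2 (1/5 + 1/10) y], which leaves [A >= y]. Times [W >= 3] this is [3 y], against a shear loss of
   at most [6/5 y]. *)
set A := _ - 2 * _.
have A_ge : y <= A by rewrite /A; have := sqr_ge0 q; lra.
have AW : y * 3 <= A * W by apply: ler_pM => //; lra.
have q2_le : (3 + 2 * q) ^+ 2 <= 12 by nra.
have zq : z ^+ 2 * (3 + 2 * q) ^+ 2 <= 5^-1 * y * 12 by apply: ler_pM => //; exact: sqr_ge0.
have qq1 : 0 <= q ^+ 2 * ((1 - 2 * y) * z) ^+ 2 by rewrite mulr_ge0 ?sqr_ge0.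
lra.
Qed.

(** Stated through [cos] and [sin] because charts see the slice at arbitrary multiples of the
    period, not only at [t = 0]. *)
Lemma profile_at0 t : cos t = 1 -> sin t = 0 ->
  [/\ scal_profile t = - 6^-1, alpha1 t = 0, beta1 t = 0 &
   - d2logvol alpha alpha1 alpha2 beta beta1 beta2 t - 2^-1 * (dlogvol alpha alpha1 beta beta1 t ^+ 2 + shear alpha alpha1 beta beta1 t ^+ 2) = 0].
Proof.
move=> c1 s0.
have y0 : osc t = 0 by rewrite /osc c1 subrr mul0r.
have y1 : dosc t = 0 by rewrite /dosc s0 mul0r.
have y2 : ddosc t = 10^-1 by rewrite ddoscE y0 subr0.
rewrite /scal_profile /d2logvol /dlogvol /shear /fibre_det /alpha1 /beta1 /alpha2 /beta2 /alpha /beta y0 y1 y2; split; try by ring.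
by field.
Qed.

End Profile.

(** * The metric on the torus *)

Lemma periodicz (U V : zmodType) (f : U -> V) (T : U) :
  periodic f T -> forall (k : int) a, f (a + T *~ k) = f a.
Proof.
move=> fT [] k a; first exact: periodicn.
by rewrite NegzE mulrNz -[in RHS](subrK (T *+ k.+1) a) periodicn.
Qed.

Lemma det_mx22 (K : comPzRingType) (A : 'M[K]_2) :
  \det A = A ord0 ord0 * A ord_max ord_max - A ord0 ord_max * A ord_max ord0.
Proof.
rewrite (expand_det_row _ ord0) !big_ord_recl big_ord0 /cofactor !det_mx11 !mxE /=.
rewrite expr0 expr1 mul1r mulN1r addr0 mulrN.
by congr (_ * _ - _ * _); congr (A _ _); exact: val_inj.
Qed.

(** The matrix determinant lemma, [det (p p^T + H) = (1 + p^T H^-1 p) det H], read off from two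
    factorisations of the block matrix with rows [1, - p^T] and [p, H]. The number [p^T H^-1 p] is
    the value of the form [H] at [q]. *)
Lemma det_add_rank1 (K : realFieldType) n (H : 'M[K]_n) (p : 'cV[K]_n) :
  H^T = H -> H \in unitmx -> 0 <= \det H ->
  (forall v : 'rV_n, 0 <= (v *m H *m v^T) 0 0) ->
  \det H <= \det (p *m p^T + H).
Proof.
move=> Hsym Hu Hd Hpos.
set q := p^T *m invmx H.
have E : block_mx 1%:M 0 p 1%:M *m block_mx 1%:M (- p^T) 0 (p *m p^T + H)
       = block_mx 1%:M (- q) 0 1%:M *m block_mx (1%:M + q *m p) 0 p H.
  rewrite !mulmx_block !mul1mx !mul0mx ?mulmx0 !mulmx1 ?addr0 ?add0r.
  by rewrite mulmxN addKr !mulNmx addrK /q mulmxKV.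
have := congr1 determinant E; rewrite !det_mulmx !det_lblock !det_ublock !det1 !mul1r.
move=> ->; rewrite ler_peMl// det_mx11 mxE [X in X + _]mxE eqxx mulr1n lerDl.
have := Hpos q; rewrite {1}/q mulmxKV// /q trmx_mul trmxK trmx_inv Hsym.
by rewrite mulmxA.
Qed.

Section PeriodicMetric.
Context {R : realType} {m : nat}.
Implicit Types (v w : 'rV[R]_m.+4) (a b : 'I_m.+4).

Definition torus_gram : 'rV[R]_m.+4 -> 'M[R]_m.+4 := warped_gram alpha beta.

Lemma cos_period (t : R) (k : int) : cos (t + period *~ k) = cos t.
Proof. exact: periodicz (@cosD2pi R) _ _. Qed.

Lemma sin_period (t : R) (k : int) : sin (t + period *~ k) = sin t.
Proof. exact: periodicz (@sinD2pi R) _ _. Qed.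

Lemma cos_periodZ (k : int) : cos (period *~ k : R) = 1.
Proof. by rewrite -[_ *~ _]add0r cos_period cos0. Qed.

Lemma sin_periodZ (k : int) : sin (period *~ k : R) = 0.
Proof. by rewrite -[_ *~ _]add0r sin_period sin0. Qed.

Lemma torus_gram_lattice v k : torus_gram (v + lattice_vector k) = torus_gram v.
Proof.
apply/matrixP => a b; rewrite !mxE /metric_entry /alpha /beta /osc !cos_period !sin_period.
by [].
Qed.

Lemma metric_entryC (s r : nat) (t x : R) : metric_entry alpha beta s r t x = metric_entry alpha beta r s t x.
Proof.
elim/nat_cases4: s => [||||s]; elim/nat_cases4: r => [||||r] //=.
by rewrite eq_sym.
Qed.

Lemma torus_gram_sym v : (torus_gram v)^T = torus_gram v.
Proof. by apply/matrixP => a b; rewrite !mxE metric_entryC. Qed.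

Lemma Ck_osc k (j : 'I_m.+4) : Ck k setT (fun v : 'rV[R]_m.+4 => osc (v 0 j)).
Proof.
rewrite (_ : (fun v => _) = fun v : 'rV[R]_m.+4 => 10^-1 + - 10^-1 * cos (v 0 j)).
  apply: Ck_add; first exact: Ck_cst.
  by apply: Ck_mul; [exact: Ck_cst|have [] := Ck_sin_cos (R := R) k j].
by apply/funext => v; rewrite /osc; field.
Qed.

Lemma torus_gram_smooth a b : smooth_on setT (fun v => torus_gram v a b).
Proof.
have cY := Ck_osc.
have cb k : Ck k setT (fun v : 'rV[R]_m.+4 => beta (v 0 tcoord)).
  rewrite (_ : (fun v => _) = fun v : 'rV[R]_m.+4 => 1 + - 2 * osc (v 0 tcoord)).
    apply: Ck_add; first exact: Ck_cst.
    by apply: Ck_mul; [exact: Ck_cst|exact: cY].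
  by apply/funext => v; rewrite /beta; ring.
have ca k : Ck k setT (fun v : 'rV[R]_m.+4 => alpha (v 0 tcoord)).
  rewrite (_ : (fun v => _) = fun v : 'rV[R]_m.+4 =>
     2 + (- 1 * osc (v 0 tcoord) + osc (v 0 tcoord) * osc (v 0 tcoord))).
    apply: Ck_add; first exact: Ck_cst.
    apply: Ck_add; last by apply: Ck_mul; exact: cY.
    by apply: Ck_mul; [exact: Ck_cst|exact: cY].
  by apply/funext => v; rewrite /alpha; ring.
have cc k : Ck k setT (fun v : 'rV[R]_m.+4 => beta (v 0 tcoord) * cos (v 0 xcoord)).
  by apply: Ck_mul => //; have [] := Ck_sin_cos (R := R) k (xcoord : 'I_m.+4).
have cs k : Ck k setT (fun v : 'rV[R]_m.+4 => beta (v 0 tcoord) * sin (v 0 xcoord)).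
  by apply: Ck_mul => //; have [] := Ck_sin_cos (R := R) k (xcoord : 'I_m.+4).
move=> k.
rewrite (_ : (fun v => _) = fun v : 'rV[R]_m.+4 => metric_entry alpha beta a b (v 0 tcoord) (v 0 xcoord)).
  move: (nat_of_ord a) (nat_of_ord b).
  elim/nat_cases4 => [||||s]; elim/nat_cases4 => [||||r] /=; try exact: Ck_cst; try exact: cs.
    by apply: Ck_add.
  rewrite (_ : (fun v => _) = fun v : 'rV[R]_m.+4 => alpha (v 0 tcoord) + -1 * (beta (v 0 tcoord) * cos (v 0 xcoord))).
    by apply: Ck_add => //; apply: Ck_mul => //; exact: Ck_cst.
  by apply/funext => v; rewrite mulN1r.
by apply/funext => v; rewrite mxE.
Qed.

End PeriodicMetric.

Section PeriodicMetricForm.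
Context {R : realType} {m : nat}.
Implicit Types (v w : 'rV[R]_m.+4) (a b : 'I_m.+4).
Local Notation torus_gram := (@torus_gram R m).

(** In fact [alpha - beta = 1 + osc + osc^2]; a constant below 1 also serves for the flat directions
    in [torus_gram_pos]. *)
Lemma alpha_sub_beta (t : R) : 4 / 5 <= alpha t - beta t /\ 0 <= beta t.
Proof. by have /andP[y0 y1] := osc_itv t; rewrite /alpha /beta; split; nra. Qed.

(** The fibre metric is [(alpha - beta) I + beta P] with [P] the identity plus a reflection. As
    [P^2 = 2 P], twice the form of [P] is a sum of two squares. *)
Lemma fibre_form_ge (alpha beta c s x y : R) : 0 <= beta -> c ^+ 2 + s ^+ 2 = 1 ->
  (alpha - beta) * (x ^+ 2 + y ^+ 2) <=
  x * (x * (alpha + beta * c) + y * (beta * s)) + y * (x * (beta * s) + y * (alpha - beta * c)).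
Proof.
move=> be0 cs.
have H : 0 <= (1 + c) * x ^+ 2 + 2 * s * x * y + (1 - c) * y ^+ 2.
  have s2 : s ^+ 2 = 1 - c ^+ 2 by rewrite -cs; ring.
  have E : 2 * ((1 + c) * x ^+ 2 + 2 * s * x * y + (1 - c) * y ^+ 2) =
      ((1 + c) * x + s * y) ^+ 2 + (s * x + (1 - c) * y) ^+ 2 by ring: s2.
  by rewrite -(pmulr_rge0 _ (ltr0Sn R 1)) E addr_ge0 ?sqr_ge0.
rewrite -subr_ge0.
have -> : x * (x * (alpha + beta * c) + y * (beta * s)) + y * (x * (beta * s) + y * (alpha - beta * c)) -
  (alpha - beta) * (x ^+ 2 + y ^+ 2) = beta * ((1 + c) * x ^+ 2 + 2 * s * x * y + (1 - c) * y ^+ 2) by ring.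
exact: mulr_ge0.
Qed.

Definition ycoord : 'I_m.+4 := @Ordinal m.+4 1 isT.
Definition zcoord : 'I_m.+4 := @Ordinal m.+4 2 isT.

Lemma mulmx_torus_gram (w v : 'rV[R]_m.+4) (b : 'I_m.+4) :
  (w *m torus_gram v) 0 b =
  match val b with
  | 1%N => w 0 ycoord * (alpha (v 0 tcoord) + beta (v 0 tcoord) * cos (v 0 xcoord)) +
           w 0 zcoord * (beta (v 0 tcoord) * sin (v 0 xcoord))
  | 2%N => w 0 ycoord * (beta (v 0 tcoord) * sin (v 0 xcoord)) +
           w 0 zcoord * (alpha (v 0 tcoord) - beta (v 0 tcoord) * cos (v 0 xcoord))
  | _ => w 0 b
  end.
Proof.
rewrite mxE; under eq_bigr do rewrite mxE.
have other (c : 'I_m.+4) : (forall a : 'I_m.+4, metric_entry alpha beta a c (v 0 tcoord) (v 0 xcoord) = (a == c)%:R) ->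
    \sum_j w 0 j * metric_entry alpha beta j c (v 0 tcoord) (v 0 xcoord) = w 0 c.
  move=> H; rewrite (bigD1 c)//= H eqxx mulr1 big1 ?addr0// => j jc.
  by rewrite H (negPf jc) mulr0.
have fib (c : 'I_m.+4) : (forall a : 'I_m.+4, a != ycoord -> a != zcoord ->
      metric_entry alpha beta a c (v 0 tcoord) (v 0 xcoord) = 0) ->
    \sum_j w 0 j * metric_entry alpha beta j c (v 0 tcoord) (v 0 xcoord) =
    w 0 ycoord * metric_entry alpha beta 1 c (v 0 tcoord) (v 0 xcoord) +
    w 0 zcoord * metric_entry alpha beta 2 c (v 0 tcoord) (v 0 xcoord).
  move=> H; rewrite (bigD1 ycoord)//= (bigD1 zcoord)//= big1 ?addr0// => j /andP[jy jz].
  by rewrite H ?mulr0.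
case: b => -[|[|[|[|b]]]] hb /=.
- by apply: (other (Ordinal hb)) => -[[|[|[|[|a]]]] ha].
- by rewrite (fib (Ordinal hb))// => -[[|[|[|a]]] ha].
- by rewrite (fib (Ordinal hb))// => -[[|[|[|a]]] ha].
- by apply: (other (Ordinal hb)) => -[[|[|[|[|a]]]] ha].
- by apply: (other (Ordinal hb)) => -[[|[|[|[|a]]]] ha].
Qed.

Lemma inner_torus_gram_t v w : inner (torus_gram v) w (delta_mx 0 tcoord) = w 0 tcoord.
Proof.
by rewrite /inner trmx_delta -colE mxE mulmx_torus_gram.
Qed.

Lemma torus_gram_pos v w : w != 0 -> 0 < inner (torus_gram v) w w.
Proof.
move=> w0; rewrite /inner mxE.
under eq_bigr do rewrite mulmx_torus_gram [w^T _ _]mxE.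
have [ab b0] := alpha_sub_beta (v 0 tcoord).
have F := @fibre_form_ge (alpha (v 0 tcoord)) (beta (v 0 tcoord)) (cos (v 0 xcoord)) (sin (v 0 xcoord))
  (w 0 ycoord) (w 0 zcoord) b0 (cos2Dsin2 _).
rewrite (bigD1 ycoord)//= (bigD1 zcoord)//=.
rewrite (eq_bigr (fun j => w 0 j ^+ 2)) => [|j /andP[]]; last first.
  by case: j => -[|[|[|j]]].
have S0 : 0 <= \sum_(j < m.+4 | (j != ycoord) && (j != zcoord)) w 0 j ^+ 2.
  by apply: sumr_ge0 => j _; exact: sqr_ge0.
have G : 4 / 5 * \sum_j w 0 j ^+ 2 > 0.
  rewrite mulr_gt0// lt_neqAle sumr_ge0 ?andbT => [|j _]; last exact: sqr_ge0.
  rewrite eq_sym; apply: contra w0 => /eqP/psumr_eq0P H.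
  apply/eqP/rowP => j; rewrite mxE; apply/eqP; rewrite -sqrf_eq0; apply/eqP.
  by apply: H => // i _; exact: sqr_ge0.
apply: lt_le_trans G _.
rewrite (bigD1 ycoord)//= (bigD1 zcoord)//=.
have Q : 4 / 5 * (w 0 ycoord ^+ 2 + w 0 zcoord ^+ 2) <=
    (alpha (v 0 tcoord) - beta (v 0 tcoord)) * (w 0 ycoord ^+ 2 + w 0 zcoord ^+ 2).
  by apply: ler_wpM2r => //; apply: addr_ge0; exact: sqr_ge0.
move: S0 F Q; set S := \sum_(_ < _ | _) _; lra.
Qed.

Definition slice_gram (t x : R) : 'M[R]_m.+3 := \matrix_(a, b) metric_entry alpha beta a.+1 b.+1 t x.

Lemma torus_gram_block v :
  torus_gram v = block_mx 1%:M 0 0 (slice_gram (v 0 tcoord) (v 0 xcoord)) :> 'M[R]_(1 + m.+3).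
Proof.
apply/matrixP => a b; rewrite [LHS]mxE.
case: (@split_ordP 1 m.+3 a) => a' ->; case: (@split_ordP 1 m.+3 b) => b' ->.
- by rewrite block_mxEul !ord1 mxE.
- by rewrite block_mxEur ord1 mxE.
- by rewrite block_mxEdl ord1 mxE /=; case: (val a') => [|[|[|k]]].
- by rewrite block_mxEdr mxE.
Qed.

Lemma det_slice_gram (t x : R) : \det (slice_gram t x) = fibre_det alpha beta t.
Proof.
have -> : slice_gram t x = block_mx (\matrix_(i < 2, j < 2) metric_entry alpha beta i.+1 j.+1 t x) 0 0 1%:M :> 'M[R]_(2 + m.+1).
  apply/matrixP => a b; rewrite [LHS]mxE.
  case: (@split_ordP 2 m.+1 a) => a' ->; case: (@split_ordP 2 m.+1 b) => b' ->.
  - by rewrite block_mxEul mxE.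
  - by rewrite block_mxEur mxE; case: a' => -[|[|]].
  - by rewrite block_mxEdl mxE /=; case: b' => -[|[|]].
  - by rewrite block_mxEdr mxE /=; case: a' b' => a' ? [b' ?].
rewrite (det_ublock (\matrix_(i < 2, j < 2) metric_entry alpha beta i.+1 j.+1 t x) 0) det1 mulr1 det_mx22 !mxE /=.
have s2 := sin2cos2 x.
by rewrite /fibre_det; ring: s2.
Qed.

Lemma slice_gram_sym (t x : R) : (slice_gram t x)^T = slice_gram t x.
Proof. by apply/matrixP => a b; rewrite !mxE metric_entryC. Qed.

Lemma row_cons_tcoord (t : R) (p : 'rV[R]_m.+3) : row_cons t p 0 tcoord = t.
Proof. exact: row_cons0. Qed.

Lemma slice_gram_psd (t x : R) (p : 'rV[R]_m.+3) : 0 <= (p *m slice_gram t x *m p^T) 0 0.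
Proof.
pose v : 'rV[R]_m.+4 := \row_j (if j == tcoord then t else x).
have vt : v 0 tcoord = t by rewrite mxE.
have vx : v 0 xcoord = x by rewrite mxE.
have -> : (p *m slice_gram t x *m p^T) 0 0 = inner (torus_gram v) (row_cons 0 p) (row_cons 0 p).
  transitivity ((row_mx (0 : 'M[R]_1) p *m block_mx 1%:M 0 0 (slice_gram t x) *m (row_mx 0 p)^T) 0 0).
    by rewrite tr_row_mx mul_row_block mul_row_col trmx0 !mulmx0 ?mul0mx !add0r.
  rewrite /inner torus_gram_block vt vx /row_cons (_ : 0%:M = 0 :> 'M[R]_1)//.
  by apply/matrixP => i j; rewrite !mxE mul0rn.
have [->|p0] := eqVneq p 0.
  rewrite (_ : row_cons 0 0 = 0); first by rewrite /inner !mul0mx mxE.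
  by apply/rowP => j; rewrite [RHS]mxE; have [k ->|->] := unliftP ord0 j; rewrite ?row_consS ?row_cons0 ?mxE.
apply/ltW/torus_gram_pos; apply: contra p0 => /eqP/rowP E; apply/eqP/rowP => j.
by have := E (lift ord0 j); rewrite row_consS !mxE.
Qed.

Lemma det_graph (t x : R) (p : 'cV[R]_m.+3) :
  fibre_det alpha beta t <= \det (p *m p^T + slice_gram t x).
Proof.
rewrite -(det_slice_gram t x); have dH := det_slice_gram t x; have d3 := fibre_det_ge3 t.
apply: det_add_rank1; first exact: slice_gram_sym.
- by rewrite unitmxE dH unitfE gt_eqF// (lt_le_trans _ d3).
- by rewrite dH (le_trans _ d3).
- exact: slice_gram_psd.
Qed.

End PeriodicMetricForm.

(** * Graphs over a slice *)

Lemma continuous_row (R : realType) (T : topologicalType) n (F : T -> 'rV[R]_n) (x : T) :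
  (forall j, {for x, continuous (fun y => F y 0 j)}) -> {for x, continuous F}.
Proof.
move=> Fc A [P Px PA].
have H j : \forall y \near x, P 0 j (F y 0 j) by apply: Fc; exact: Px.
change (nbhs x (F @^-1` A)).
apply: filterS (@filter_forall _ _ _ _ _ H) => y Hy; apply: PA => i j.
by rewrite ord1; exact: Hy.
Qed.

Lemma continuous_row_cons (R : realType) (T : topologicalType) n (f : T -> R)
    (F : T -> 'rV[R]_n) (x : T) :
  {for x, continuous f} -> {for x, continuous F} ->
  {for x, continuous (fun y => row_cons (f y) (F y))}.
Proof.
move=> fc Fc; apply: continuous_row => j.
have [k ->|->] := unliftP ord0 j.
  rewrite (_ : (fun y => _) = (fun v : 'rV[R]_n => v 0 k) \o F).
    by apply: continuous_comp => //; exact: coord_continuous.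
  by apply/funext => y; rewrite row_consS.
by rewrite (_ : (fun y => _) = f)//; apply/funext => y; rewrite row_cons0.
Qed.

Section TorusFunctions.
Context {R : realType} {d : nat}.

Lemma smooth_fun_continuous (u : @torus_manifold R d -> R) : smooth_fun u -> continuous u.
Proof.
move=> us p; have [i _ [v bv vp]] := box_cover p; rewrite -vp.
have [/= uc _] := us i 0%N.
have {}uc : {for v, continuous (u \o torus_pi)} by apply: uc; rewrite torus_cod.
have dp : (torus_pi @` box i) (torus_pi v) by exists v.
have H : {for torus_pi v, continuous ((u \o torus_pi) \o chart i)}.
  apply: continuous_comp; first exact: chart_continuous dp.
  by rewrite chartK.
apply: near_continuous H.
have od : open (torus_pi @` @box R d i) by exact/open_torus_pi/open_box.
apply: filterS (open_nbhs_nbhs (conj od dp)) => q /chart_dom[_ qE].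
by rewrite /= qE.
Qed.

End TorusFunctions.

Section Graph.
Context {R : realType} {m : nat}.
Local Notation NN := (@torus_manifold R m).
Local Notation MM := (@torus_manifold R m.+1).
Implicit Types (u : NN -> R) (v x : 'rV[R]_m).

(** The choice of [repr] is not continuous, but another lift changes the row by a lattice vector
    only, as [graph_torus_pi] records. Sigma itself is the graph of [0]. *)
Definition graph u (p : NN) : MM := torus_pi (row_cons (u p) (repr (p : torus R m))).

Lemma row_consD (s t : R) v x : row_cons s v + row_cons t x = row_cons (s + t) (v + x).
Proof.
apply/rowP => j; rewrite [LHS]mxE; have [k ->|->] := unliftP ord0 j.
  by rewrite !row_consS mxE.
by rewrite !row_cons0.
Qed.

Lemma lattice_row_cons (k : 'I_m -> int) :
  exists l, row_cons 0 (lattice_vector k) = lattice_vector l :> 'rV[R]_m.+1.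
Proof.
exists (fun j => if unlift ord0 j is Some i then k i else 0).
apply/rowP => j; rewrite [RHS]mxE; have [i ->|->] := unliftP ord0 j.
  by rewrite row_consS mxE.
by rewrite row_cons0.
Qed.

Lemma torus_pi_row_cons (t : R) v x : torus_pi v = torus_pi x -> torus_pi (row_cons t v) = torus_pi (row_cons t x).
Proof.
move=> /torus_piP[k ->]; have [l lE] := lattice_row_cons k.
by apply/torus_piP; exists l; rewrite -lE row_consD addr0.
Qed.

Lemma graph_torus_pi u v : graph u (torus_pi v) = torus_pi (row_cons (u (torus_pi v)) v).
Proof. by apply: torus_pi_row_cons; exact: torus_pi_repr. Qed.

Lemma graph_inj u : injective (graph u).
Proof.
move=> p q /torus_piP[k kE]; rewrite -(torus_pi_repr p) -(torus_pi_repr q); apply/torus_piP.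
exists (fun j => k (lift ord0 j)); apply/rowP => j.
have /rowP/(_ (lift ord0 j)) := kE.
by rewrite row_consS [X in _ = X]mxE row_consS !mxE.
Qed.

Section Smooth.
Variables (u : NN -> R).
Hypothesis us : smooth_fun u.

Lemma continuous_lift v : {for v, continuous (fun y => u (torus_pi y))}.
Proof.
apply: (@continuous_comp _ _ _ (@torus_pi R m) u); first exact: torus_pi_continuous.
exact: smooth_fun_continuous.
Qed.

Lemma continuous_graph_lift v : {for v, continuous (fun y => row_cons (u (torus_pi y)) y)}.
Proof. by apply: continuous_row_cons; [exact: continuous_lift|exact: cvg_id]. Qed.

Lemma continuous_graph : continuous (graph u).
Proof.
apply/quotient_continuous => v.
rewrite (_ : _ \o _ = torus_pi \o (fun y => row_cons (u (torus_pi y)) y)).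
  by apply: continuous_comp; [exact: continuous_graph_lift|exact: torus_pi_continuous].
by apply/funext => y; exact: graph_torus_pi.
Qed.

Lemma graph_local i j x : box i x -> dom MM j (graph u (prm NN i x)) ->
  exists k, \forall y \near x,
    local_rep (graph u : NN -> MM) i j y = row_cons (u (torus_pi y)) y + lattice_vector k.
Proof.
move=> bx [w bw]; rewrite graph_torus_pi => wE.
have [k [_ H]] := chart_near bw (esym wE); exists k.
have {}H : nbhs x [set y | box j (row_cons (u (torus_pi y)) y + lattice_vector k) /\
    chart j (torus_pi (row_cons (u (torus_pi y)) y)) = row_cons (u (torus_pi y)) y + lattice_vector k].
  exact: continuous_graph_lift H.
by apply: filterS H => y [_ <-]; rewrite /local_rep /= graph_torus_pi.
Qed.

End Smooth.
End Graph.

(** * Iterated lower integrals *)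

Section LowerIntegral.
Local Open Scope ereal_scope.
Context d (T : measurableType d) (R : realType) (mu : {measure set T -> \bar R}).
Implicit Types f g : T -> \bar R.

(* The integral of a nonnegative function is a supremum over simple functions,
   so monotonicity and superadditivity need no measurability. *)
Lemma le_integral_ge0 f g : (forall x, 0 <= f x) -> (forall x, f x <= g x) ->
  \int[mu]_x f x <= \int[mu]_x g x.
Proof.
move=> f0 fg; have g0 x : 0 <= g x by exact: le_trans (fg x).
rewrite !ge0_integralTE//; apply: le_ereal_sup => _ [h /= hf <-].
by exists h => // x; exact: le_trans (fg x).
Qed.

Lemma integral_superadd f g : (forall x, 0 <= f x) -> (forall x, 0 <= g x) ->
  \int[mu]_x f x + \int[mu]_x g x <= \int[mu]_x (f x + g x).
Proof.
move=> f0 g0; rewrite !ge0_integralTE//; last by move=> x; exact: adde_ge0.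
set A := [set _ | _ in _]; set B := [set _ | _ in _]; set C := [set _ | _ in _].
have AB a b : A a -> B b -> a + b <= ereal_sup C.
  move=> [h /= hf <-] [k /= kg <-]; rewrite -sintegralD; apply: ereal_sup_ubound.
  by exists (add_nnsfun h k) => // x /=; rewrite EFinD; exact: leeD.
have B0 : B 0 by exists nnsfun0 => //=; exact: sintegral0.
have A0 : A 0 by exists nnsfun0 => //=; exact: sintegral0.
have [|Cfin] := eqVneq (ereal_sup C) +oo; first by move=> ->; rewrite leey.
have C0 : 0 <= ereal_sup C by rewrite -[0]adde0; exact: AB.
have {}Cfin : ereal_sup C \is a fin_num by rewrite ge0_fin_numE// lt_neqAle Cfin leey.
have Ale a : A a -> a <= ereal_sup C by move=> Aa; rewrite -[a]adde0; exact: AB.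
have supB a : A a -> a \is a fin_num -> ereal_sup B <= ereal_sup C - a.
  move=> Aa af; apply: ge_ereal_sup => b Bb.
  by rewrite leeBrDr// addeC; exact: AB.
have Bfin : ereal_sup B \is a fin_num.
  rewrite ge0_fin_numE; last exact: ereal_sup_ubound.
  by have := supB 0 A0 isT; rewrite sube0 => /le_lt_trans; apply; rewrite -ge0_fin_numE.
rewrite -leeBrDr//; apply: ge_ereal_sup => a Aa.
have af : a \is a fin_num.
  have a0 : 0 <= a by move: Aa => [h /= _ <-]; exact: sintegral_ge0.
  by rewrite ge0_fin_numE// (le_lt_trans (Ale a Aa))// -ge0_fin_numE.
by rewrite leeBrDr// addeC -leeBrDr//; exact: supB.
Qed.

End LowerIntegral.

Section IteratedIntegral.
Local Open Scope ereal_scope.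
Context {R : realType}.

Lemma iint_ge0 m (f : 'rV[R]_m -> \bar R) : (forall x, 0 <= f x) -> 0 <= iint f.
Proof.
by elim: m f => [|m IH] f f0 /=; [exact: f0|apply: integral_ge0 => t _; exact: IH].
Qed.

Lemma le_iint m (f g : 'rV[R]_m -> \bar R) :
  (forall x, 0 <= f x) -> (forall x, f x <= g x) -> iint f <= iint g.
Proof.
elim: m f g => [|m IH] f g f0 fg /=; first exact: fg.
by apply: le_integral_ge0 => t; [exact: iint_ge0|exact: IH].
Qed.

(** Used to add the gain on a small cube to the area of the slice; this direction is the one that
    bounds the area of a graph from below. *)
Lemma iint_superadd m (f g : 'rV[R]_m -> \bar R) :
  (forall x, 0 <= f x) -> (forall x, 0 <= g x) ->
  iint f + iint g <= iint (fun x => f x + g x).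
Proof.
elim: m f g => [|m IH] f g f0 g0 //=.
apply: (le_trans (integral_superadd _ _ _)) => [t|t|]; try exact: iint_ge0.
apply: le_integral_ge0 => t; last exact: IH.
by apply: adde_ge0; exact: iint_ge0.
Qed.

Definition cube m (a : 'rV[R]_m) (l : R) : set 'rV[R]_m :=
  [set x | forall j, (a 0%R j <= x 0%R j <= a 0%R j + l)%R].

Lemma iint0 (m : nat) : iint (fun _ : 'rV[R]_m => 0) = 0.
Proof. by elim: m => [|m IH] //=; apply: integral0_eq => t _. Qed.

Lemma iint_cube m (a : 'rV[R]_m) (l C : R) : (0 <= l)%R ->
  iint ((fun=> C%:E) \_ (cube a l)) = (C * l ^+ m)%:E.
Proof.
move=> l0; elim: m a => [|m IH] a /=.
  by rewrite patchE expr0 mulr1 ifT// inE => -[].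
pose a0 := a 0%R ord0; pose a' : 'rV[R]_m := (\row_j a 0 (lift ord0 j))%R.
rewrite (_ : (fun t : R => _) =
    (fun=> (C * l ^+ m)%:E) \_ `[a0, (a0 + l)%R]); last first.
  apply/funext => t; rewrite [RHS]patchE; case: ifPn => [|/negP].
    rewrite inE/= in_itv/= => ta; rewrite -(IH a'); congr iint; apply/funext => y.
    rewrite !patchE; congr (if _ then _ else _); apply/idP/idP; rewrite !inE => H j.
      by have := H (lift ord0 j); rewrite row_consS mxE.
    have [k ->|->] := unliftP ord0 j; last by rewrite row_cons0.
    by have := H k; rewrite row_consS mxE.
  rewrite inE/= in_itv/= => ta; rewrite -[RHS](iint0 m); congr iint.
  apply/funext => y; rewrite patchE ifN//; apply/negP; rewrite inE => H; apply: ta.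
  by have := H ord0; rewrite row_cons0.
rewrite -integral_mkcond (integral_cst lebesgue_measure)//= lebesgue_measure_itv /=.
rewrite lte_fin ltrDl; case: ltP => [l1|l1].
  by rewrite -EFinB -EFinM addrAC subrr add0r exprSr mulrA.
have -> : l = 0%R by apply/eqP; rewrite eq_le l1 l0.
by rewrite mule0 expr0n mulr0.
Qed.

End IteratedIntegral.

(** * Geometry of graphs *)

Section TorusMetric.
Context {R : realType}.

Lemma jac_translation n (F : 'rV[R]_n -> 'rV[R]_n) (x c : 'rV[R]_n) :
  (\forall y \near x, F y = y + c) -> jac F x = 1%:M.
Proof.
move=> Fc; apply/matrixP => a b; rewrite !mxE.
have H : \forall y \near x, F y 0 b = y 0 b + c 0 b.
  by apply: filterS Fc => y ->; rewrite mxE.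
rewrite (nbhs_singleton (near_partial a H)) partial_addc partial_coord.
by [].
Qed.

Lemma jac_transition n i j (p : @torus_manifold R n) :
  dom (@torus_manifold R n) i p -> dom (@torus_manifold R n) j p ->
  jac (transition (@torus_manifold R n) i j) (crd (@torus_manifold R n) i p) = 1%:M /\
  exists k, crd (@torus_manifold R n) j p = crd (@torus_manifold R n) i p + lattice_vector k.
Proof.
move=> [v bv <-] [w bw wv].
have [k [wE H]] := chart_near bw (esym wv).
rewrite /= chartK//; split; last by exists k; rewrite -wv chartK// wE.
by apply: (@jac_translation _ _ _ (lattice_vector k)); apply: filterS H => y [].
Qed.

Definition torus_metric m : metric (@torus_manifold R m.+4).
Proof.
refine (@Metric R m.+4 (@torus_manifold R m.+4) (fun=> @torus_gram R m) _ _ _ _).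
- by move=> i a b; apply: smooth_onT; exact: torus_gram_smooth.
- by move=> i x _; exact: torus_gram_sym.
- by move=> i x v _; exact: torus_gram_pos.
- move=> i j p pi pj J.
  have [JE [k ->]] := jac_transition pi pj.
  by rewrite /J JE mul1mx trmx1 mulmx1 torus_gram_lattice.
Defined.

End TorusMetric.

Section GraphGeometry.
Context {R : realType} {m : nat}.
Local Notation NN := (@torus_manifold R m).
Local Notation MM := (@torus_manifold R m.+1).
Variable u : NN -> R.
Hypothesis us : smooth_fun u.

Lemma local_rep_entries i j x : box i x -> dom MM j (graph u (prm NN i x)) ->
  exists k : 'I_m.+1 -> int,
  (\forall y \near x, local_rep (graph u : NN -> MM) i j y 0 ord0 = u (torus_pi y) + period *~ k ord0) /\
  (forall b, \forall y \near x,
     local_rep (graph u : NN -> MM) i j y 0 (lift ord0 b) = y 0 b + period *~ k (lift ord0 b)).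
Proof.
move=> bx dx; have [k H] := graph_local us bx dx; exists k; split => [|b].
  by apply: filterS H => y ->; rewrite [LHS]mxE row_cons0 mxE.
by apply: filterS H => y ->; rewrite [LHS]mxE row_consS mxE.
Qed.

Lemma smooth_map_graph : smooth_map (graph u : NN -> MM).
Proof.
split; first exact: continuous_graph.
move=> i j b; apply: smooth_on_near => x [_ [[v bv <-] dv] <-].
rewrite [crd NN i _]/= chartK//.
have [k [H0 HS]] := local_rep_entries bv dv.
have [c ->|->] := unliftP ord0 b.
  exists (fun y => y 0 c + period *~ k (lift ord0 c)); first exact: HS.
  by move=> l; apply: Ck_addc; apply: Ck_sub (Ck_coord l c).
exists (fun y => u (torus_pi y) + period *~ k ord0); first exact: H0.
move=> l; apply: Ck_addc; apply: Ck_sub (us i l).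
by move=> _ ->; rewrite torus_cod.
Qed.

Lemma jac_graph_normal i j x a : box i x -> dom MM j (graph u (prm NN i x)) ->
  jac (local_rep (graph u : NN -> MM) i j) x a ord0 = partial a (fun y => u (torus_pi y)) x.
Proof.
move=> bx dx; have [k [H0 _]] := local_rep_entries bx dx.
by rewrite mxE (nbhs_singleton (near_partial a H0)) partial_addc.
Qed.

Lemma jac_graph i j x : box i x -> dom MM j (graph u (prm NN i x)) ->
  jac (local_rep (graph u : NN -> MM) i j) x =
    row_mx (\col_a partial a (fun y => u (torus_pi y)) x) 1%:M :> 'M[R]_(m, 1 + m).
Proof.
move=> bx dx; have [k [_ HS]] := local_rep_entries bx dx.
apply/matrixP => a b; have [c ->|->] := unliftP ord0 b.
  rewrite [LHS]mxE (nbhs_singleton (near_partial a (HS c))) partial_addc partial_coord.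
  have := row_mxEr (\col_a partial a (fun y => u (torus_pi y)) x) 1%:M a c; rewrite [X in _ = X]mxE => <-.
  by congr (row_mx _ _ _ _); exact: val_inj.
rewrite jac_graph_normal//.
have := row_mxEl (\col_a partial a (fun y => u (torus_pi y)) x) 1%:M a ord0; rewrite [X in _ = X]mxE => <-.
by congr (row_mx _ _ _ _); exact: val_inj.
Qed.

Lemma closed_hypersurface_graph : @closed_hypersurface R m.+1 NN MM (graph u).
Proof.
split.
- exact: torus_compact.
- by exists (torus_pi 0).
- exact: graph_inj.
- split; first exact: smooth_map_graph.
  move=> i j _ [v bv <-] dv; rewrite [crd NN i _]/= chartK//.
  rewrite [jac _ _](jac_graph bv dv); set c := \col_a _.
  have : row_mx c 1%:M *m col_mx (0 : 'M[R]_(1, m)) 1%:M = 1%:M.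
    by rewrite mul_row_col mulmx0 add0r mulmx1.
  by move=> E; apply/row_freeP; exists (col_mx (0 : 'M[R]_(1, m)) 1%:M).
Qed.

End GraphGeometry.

(** * Normal geodesics and the extrinsic geometry of the slice *)

Lemma affine_near (R : realType) (f : R -> R) (t A B : R) :
  (\forall s \near t, f s = s * A + B) ->
  [/\ derivable f t 1, derive1 f t = A, derivable (derive1 f) t 1 & derive1 (derive1 f) t = 0].
Proof.
move=> fE.
have dA (s : R) : is_derive s 1 (fun s : R => s * A + B) A.
  by apply: is_derive_eq; rewrite /GRing.scale /=; ring.
have f'E : \forall s \near t, cst A s = derive1 f s.
  have /nbhs_interior H := fE; apply: filterS H => s fs.
  rewrite derive1E (near_eq_derive _ fs); by case: (dA s).
have gE : \forall s \near t, s * A + B = f s by apply: filterS fE => s ->.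
split.
- by apply: near_eq_derivable gE _; case: (dA t).
- by rewrite -(nbhs_singleton f'E).
- by apply: near_eq_derivable f'E _; exact: derivable_cst.
- by rewrite derive1E -(near_eq_derive _ f'E) derive_cst.
Qed.

Section Geodesics.
Context {R : realType} {m : nat}.
Local Notation NN := (@torus_manifold R m.+3).
Local Notation MM := (@torus_manifold R m.+4).
Local Notation g := (@torus_metric R m).

(** The [t]-lines are geodesics because every symbol with lower indices [t, t] vanishes. *)
Lemma graph_is_exp (u : NN -> R) (p : NN) :
  is_exp g (graph (fun=> 0) p : MM) (fun=> u p *: delta_mx 0 tcoord) (graph u p : MM).
Proof.
pose v := repr (p : torus R m.+3).
pose c (s : R) : MM := torus_pi (row_cons (s * u p) v).
have line k s : row_cons (s * u p) v 0 k = s * (u p * (k == ord0)%:R) + row_cons 0 v 0 k.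
  have [j ->|->] := unliftP ord0 k; first by rewrite !row_consS mulr0 mulr0 add0r.
  by rewrite !row_cons0 eqxx mulr1 addr0.
have cc t : {for t, continuous (fun s : R => row_cons (s * u p) v)}.
  apply: continuous_row_cons; last exact: cvg_cst.
  exact: (cvgM (@cvg_id _ (nbhs t)) (cvg_cst _)).
have near_c t i : dom MM i (c t) -> exists l : 'rV[R]_m.+4, forall k,
    \forall s \near t, crd MM i (c s) 0 k = s * (u p * (k == ord0)%:R) + l 0 k.
  move=> [w bw /esym wE]; have [l [_ H]] := chart_near bw wE.
  exists (row_cons 0 v + lattice_vector l) => k.
  have {}H : nbhs t [set s | box i (row_cons (s * u p) v + lattice_vector l) /\
     chart i (c s) = row_cons (s * u p) v + lattice_vector l] by exact: (cc t _ H).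
  by apply: filterS H => s [_ /= ->]; rewrite [LHS]mxE line [in RHS]mxE addrA.
(* The line exists for all times; any open interval containing [[0, 1]] serves. *)
exists (-1), 2, c; split; rewrite ?ltrN10 ?ltr1n//.
- move=> t _; split.
    apply: continuous_comp; [exact: cc|exact: torus_pi_continuous].
  move=> i di y k; have [l lP] := near_c t i di.
  have [d1 e1 d2 e2] := affine_near (lP k).
  split=> //; rewrite e2 add0r big1// => a _; rewrite big1// => b _.
  have [_ ea _ _] := affine_near (lP a); have [_ eb _ _] := affine_near (lP b).
  rewrite ea eb; have [->|] := eqVneq a ord0; last by rewrite mulr0 mulr0 mul0r.
  have [->|] := eqVneq b ord0; last by rewrite !mulr0.
  rewrite [g i]/= /torus_gram (christoffel_warped_gram (@is_derive_alpha R) (@is_derive_beta R) (@fibre_det_neq0 R)).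
  suff -> : Gamma alpha alpha1 beta beta1 k 0 0 (crd MM i (c t) 0 tcoord) (crd MM i (c t) 0 xcoord) = 0 by rewrite !mul0r.
  by move: (nat_of_ord k); elim/nat_cases4 => [||||j] //=; rewrite mulr0.
- by rewrite /c mul0r mul1r.
- move=> i k di; have d0 : dom MM i (c 0) by rewrite /c mul0r.
  have [l lP] := near_c 0 i d0; have [_ -> _ _] := affine_near (lP k).
  by rewrite !mxE eqxx.
Qed.

Lemma unit_normal_graph0 :
  unit_normal_field g (graph (fun=> 0) : NN -> MM) (fun=> fun=> delta_mx 0 tcoord).
Proof.
have s0 : @smooth_fun R m.+3 NN (fun=> 0) by move=> i k; exact: Ck_cst.
split.
- by move=> i j p pi pj; have [-> _] := jac_transition pi pj; rewrite mulmx1.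
- by move=> i j b k; exact: Ck_cst.
- by move=> j p _; rewrite inner_torus_gram_t mxE !eqxx.
- move=> i j p w [v bv <-] dj; rewrite [crd NN i _]/= chartK// inner_torus_gram_t.
  rewrite mxE big1// => a _.
  by rewrite [X in _ * X](jac_graph_normal s0 a bv dj) /partial derive_cst mulr0.
Qed.

(** A chart with corner [pi] in the direction [t] sees the slice at [t = 2 pi]. *)
Lemma graph0_coord (i : nat) (p : NN) : dom MM i (graph (fun=> 0) p) ->
  exists k : int, crd MM i (graph (fun=> 0) p) 0 tcoord = period *~ k.
Proof.
move=> [w bw wE]; have [k [E _]] := chart_near bw (esym wE).
by exists (k ord0); rewrite -wE [crd MM i _]/= chartK// E mxE row_cons_tcoord add0r mxE.
Qed.

(** The second fundamental form of a slice is minus half the [t]-derivative of [h], and [alpha1] and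
    [beta1] vanish together with [sin t]. *)
Lemma totally_geodesic_graph0 :
  totally_geodesic g (graph (fun=> 0) : NN -> MM) (fun=> fun=> delta_mx 0 tcoord).
Proof.
have s0 : @smooth_fun R m.+3 NN (fun=> 0) by move=> i k; exact: Ck_cst.
move=> i j p [v bv <-] dj; rewrite [crd NN i _]/= chartK//.
apply/matrixP => a b; rewrite [LHS]mxE inner_torus_gram_t [LHS]mxE mxE.
have [k [H0 _]] := local_rep_entries s0 bv dj.
have H1 := near_partial b H0.
have H2 : \forall y \near v, partial b (fun z => local_rep (graph (fun=> 0) : NN -> MM) i j z 0 ord0) y = cst 0 y.
  by apply: filterS H1 => y ->; rewrite /partial derive_cst.
rewrite (nbhs_singleton (near_partial a H2)) /partial derive_cst add0r.
rewrite big1// => c _; rewrite big1// => d _.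
rewrite (christoffel_warped_gram (@is_derive_alpha R) (@is_derive_beta R) (@fibre_det_neq0 R)).
rewrite (nbhs_singleton H0) add0r.
have [_ al0 be0 _] := profile_at0 (@cos_periodZ R (k ord0)) (@sin_periodZ R (k ord0)).
have H (x : R) : Gamma alpha alpha1 beta beta1 0 c d (period *~ k ord0) x = 0.
  rewrite /Gamma; move: (nat_of_ord c) (nat_of_ord d).
  by elim/nat_cases4 => [||||c']; elim/nat_cases4 => [||||d'] //=;
    rewrite ?al0 ?be0 ?mul0r ?addr0 ?subr0 ?mulr0.
by rewrite H !mul0r.
Qed.

Lemma scalar_curvature_torus_gram (v : 'rV[R]_m.+4) :
  scalar_curvature (@torus_gram R m) v = scal_profile (v 0 tcoord).
Proof.
by rewrite (scalar_curvature_warped_gram (@is_derive_alpha R) (@is_derive_alpha1 R)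
  (@is_derive_beta R) (@is_derive_beta1 R) (@fibre_det_neq0 R)).
Qed.

Lemma ricci_normal_graph0 (i : nat) (p : NN) : dom MM i (graph (fun=> 0) p) ->
  inner (ricci (g i) (crd MM i (graph (fun=> 0) p))) (delta_mx 0 tcoord) (delta_mx 0 tcoord) = 0.
Proof.
move=> /graph0_coord[k kE].
rewrite /inner trmx_delta -rowE -colE [LHS]mxE [LHS]mxE [g i]/=.
rewrite (ricci_warped_gram_tt (@is_derive_alpha R) (@is_derive_alpha1 R)
  (@is_derive_beta R) (@is_derive_beta1 R) (@fibre_det_neq0 R)) kE.
by have [] := profile_at0 (@cos_periodZ R k) (@sin_periodZ R k).
Qed.

End Geodesics.

(** * Comparison of areas *)

Lemma lt_nneseries (R : realType) (A B : nat -> \bar R) :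
  (forall i, 0 <= A i)%E -> (forall i, A i <= B i)%E -> (A 0%N < B 0%N)%E ->
  (forall i, A i < +oo)%E -> (exists N, forall i, (N <= i)%N -> A i = 0%E) ->
  (\sum_(0 <= i <oo) A i < \sum_(0 <= i <oo) B i)%E.
Proof.
move=> A0 AB AB0 Afin [N AN].
(* Strictness in the first term survives only if the remaining sum of [A] is finite. *)
have Atail : (\sum_(1 <= i <oo) A i < +oo)%E.
  rewrite (nneseries_split 1%N N) => [|i _]; last exact: A0.
  rewrite [X in (_ + X)%E]eseries0 => [|i Ni _]; last by apply: AN; exact: ltnW.
  by rewrite adde0; apply: lte_sum_pinfty => i _; exact: Afin.
have B0 i : (0 <= B i)%E by exact: le_trans (AB i).
rewrite (@nneseries_recl _ _ A)// (@nneseries_recl _ _ B)//.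
rewrite lte_leD// ?ge0_fin_numE//; first exact: nneseries_ge0.
by apply: lee_nneseries => // i _; exact: AB.
Qed.

Section Area.
Context {R : realType} {m : nat}.
Local Notation NN := (@torus_manifold R m.+3).
Local Notation MM := (@torus_manifold R m.+4).
Local Notation g := (@torus_metric R m).

(** The coordinate [y] is left open: neither [det_graph] nor [det_slice_gram] depends on it. The
    column [p] is kept explicit so that it can be seen to vanish for [u = 0]. *)
Lemma area_density_graph (u : NN -> R) i x : smooth_fun u -> box i x ->
  exists (p : 'cV[R]_m.+3) (y : R),
    area_density g (graph u : NN -> MM) i x = Num.sqrt (\det (p *m p^T + slice_gram (u (torus_pi x)) y)) /\
    p = \col_a partial a (fun y => u (torus_pi y)) x.
Proof.
move=> us bx; set p := \col_a _.
exists p, (row_cons (u (torus_pi x)) x 0 xcoord); split=> //.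
rewrite /area_density; set j := xget _ _.
have dj : dom MM j (graph u (prm NN i x)).
  have [k _ dk] := box_cover (graph u (prm NN i x)).
  exact: (@xgetPex _ 0%N [set j | dom MM j (graph u (prm NN i x))] (ex_intro _ k dk)).
have E (H : 'M[R]_m.+3) : row_mx p 1%:M *m block_mx (1%:M : 'M[R]_1) 0 0 H *m (row_mx p 1%:M)^T = p *m p^T + H.
  by rewrite tr_row_mx mul_row_block mul_row_col !mulmx0 !mulmx1 addr0 add0r trmx1 mulmx1 mul1mx.
have -> : g j (crd MM j (graph u (prm NN i x))) =
    block_mx 1%:M 0 0 (slice_gram (u (torus_pi x)) (row_cons (u (torus_pi x)) x 0 xcoord)) :> 'M[R]_(1 + m.+3).
  have := dj; rewrite [prm NN i x]/= graph_torus_pi => -[w bw wE].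
  have [k [kE _]] := chart_near bw (esym wE).
  by rewrite -wE [crd MM j _]/= chartK// kE [g j]/= torus_gram_lattice torus_gram_block row_cons_tcoord.
rewrite [jac _ _](jac_graph us bx dj) -/p; congr (Num.sqrt (\det _)); exact: E.
Qed.

Lemma area_density_graph_ge (u : NN -> R) i x : smooth_fun u -> box i x ->
  Num.sqrt (fibre_det alpha beta (u (torus_pi x))) <= area_density g (graph u : NN -> MM) i x.
Proof.
move=> us bx; have [p [y [-> _]]] := area_density_graph us bx.
rewrite ler_sqrt; first exact: det_graph.
exact: le_trans (le_trans _ (fibre_det_ge3 _)) (det_graph _ _ _).
Qed.

Lemma smooth_fun0 : @smooth_fun R m.+3 NN (fun=> 0).
Proof. by move=> i k; exact: Ck_cst. Qed.

Lemma fibre_det0 : fibre_det alpha beta 0 = 3 :> R.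
Proof. by rewrite fibre_detE /osc cos0; ring. Qed.

Lemma area_density_graph0 i x : box i x ->
  area_density g (graph (fun=> 0) : NN -> MM) i x = Num.sqrt 3.
Proof.
move=> bx; have [p [y [-> pE]]] := area_density_graph smooth_fun0 bx.
have -> : p = 0 by rewrite pE; apply/colP => a; rewrite !mxE /partial derive_cst.
by rewrite mul0mx add0r det_slice_gram fibre_det0.
Qed.

Lemma fresh_piece_box i x : fresh_piece (R := R) (n := m.+4) NN i x -> box i x.
Proof. by rewrite /fresh_piece torus_cod => -[]. Qed.

Lemma fresh_piece0 : fresh_piece (R := R) (n := m.+4) NN 0 = box 0.
Proof. by apply/seteqP; split=> x; rewrite /fresh_piece torus_cod => // -[]. Qed.

Lemma fresh_piece_ge i : (#|{ffun 'I_m.+3 -> bool}| <= i)%N ->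
  fresh_piece (R := R) (n := m.+4) NN i = set0.
Proof.
move=> Ni; apply/seteqP; split=> // x [_ H].
have [k kN dk] := box_cover (torus_pi x : torus R m.+3).
exact: H k (leq_trans kN Ni) dk.
Qed.

(** As [1 - osc >= 4/5], the product vanishes only where [cos t = 1], and on [[0, pi]] this happens
    only at [0]. *)
Lemma fibre_det_gt3 (t : R) : -1 < t < 1 -> t != 0 -> 3 < fibre_det alpha beta t.
Proof.
move=> t1 t0; rewrite fibre_detE ltrDl exprn_even_gt0//= mulf_neq0//.
  rewrite /osc mulf_neq0//.
  rewrite subr_eq0 eq_sym -cos_norm; apply: contra t0 => /eqP c1.
  have t1' : `|t| <= 1 by rewrite ler_norml; have /andP[/ltW -> /ltW ->] := t1.
  have torus_pi : `|t| <= pi by apply: le_trans t1' (le_trans _ (pi_ge2 R)); rewrite ler1n.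
  rewrite -normr_eq0; apply/eqP/(@cos_inj R); rewrite ?cos0//.
    by rewrite in_itv/= normr_ge0.
  by rewrite in_itv/= lexx pi_ge0.
by have := osc_itv t; rewrite subr_eq0 => /andP[y0 y1]; apply/eqP => E; lra.
Qed.

Lemma continuous_fibre_det : continuous (fibre_det alpha beta : R -> R).
Proof.
move=> t; apply: differentiable_continuous; apply/derivable1_diffP.
have da := is_derive_alpha t; have db := is_derive_beta t.
by rewrite /fibre_det; apply: ex_derive.
Qed.

(* The fresh piece of the chart 0 is a whole box, and this box is dense: the gain
   of area of a graph is located there. *)
Lemma box0_dense (p : torus R m.+3) (A : set (torus R m.+3)) : nbhs p A ->
  exists2 v, box 0 v & A (torus_pi v).
Proof.
move=> pA; have T0 := @period_gt0 R.
have /choice[k kP] : forall j, exists k : int,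
    corner 0 j <= repr p 0 j + period *~ k < corner 0 j + period.
  by move=> j; exact: reduce_period.
pose v := repr p + lattice_vector k.
have vp : torus_pi v = p by rewrite torus_pi_lattice torus_pi_repr.
(* The reduced lift may sit on lower faces of the half-open box; a small positive shift along the
   diagonal moves it off all of them at once. *)
pose w (s : R) : 'rV[R]_m.+3 := v + s *: const_mx 1.
have wE s j : w s 0 j = v 0 j + s by rewrite !mxE mulr1.
have w0 : w 0 = v by rewrite /w scale0r addr0.
have cw : {for 0, continuous w}.
  apply: continuous_row => j; rewrite (_ : (fun s => w s 0 j) = fun s => v 0 j + s).
    exact: (cvgD (cvg_cst _) (@cvg_id _ (nbhs (0 : R)))).
  by apply/funext => s; exact: wE.
have H1 : \forall s \near (0 : R), A (torus_pi (w s)).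
  have : {for 0, continuous (torus_pi \o w)}.
    by apply: continuous_comp => //; exact: torus_pi_continuous.
  by apply; rewrite /= w0 vp.
have H2 j : \forall s \near (0 : R), w s 0 j < corner 0 j + period.
  have c : {for 0, continuous (fun s => w s 0 j)}.
    rewrite (_ : (fun s => w s 0 j) = fun s => v 0 j + s); last by apply/funext => s; exact: wE.
    exact: (cvgD (cvg_cst _) (@cvg_id _ (nbhs (0 : R)))).
  have h : nbhs (w 0 0 j) [set y | y < corner 0 j + period].
    by apply: lt_nbhsl; rewrite w0 !mxE; have /andP[] := kP j.
  exact: (c _ h).
have [s [s0 As sl]] : exists s : R, [/\ 0 < s, A (torus_pi (w s)) & forall j, w s 0 j < corner 0 j + period].
  have H : \forall s \near (0 : R)^'+, A (torus_pi (w s)) /\ forall j, w s 0 j < corner 0 j + period.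
    apply: cvg_within; apply: filterS2 H1 (@filter_forall _ _ _ _ _ H2) => s ? ?; by split.
  have /filter_ex [s [s0 [? ?]]] : \forall s \near (0 : R)^'+, 0 < s /\
     (A (torus_pi (w s)) /\ forall j, w s 0 j < corner 0 j + period).
    by apply: filterS2 (nbhs_right_gt (0 : R)) H => s ? ?; split.
  by exists s.
exists (w s) => // j; rewrite sl andbT wE; have /andP[kj _] := kP j.
have vj : v 0 j = repr p 0 j + period *~ k j by rewrite !mxE.
by rewrite vj (le_lt_trans kj)// ltrDl.
Qed.

Lemma nbhs_cube n (x : 'rV[R]_n) (A : set 'rV[R]_n) : nbhs x A ->
  exists a l, 0 < l /\ cube a l `<=` A.
Proof.
move=> /nbhs_ballP[e /= e0 eA]; exists (x - (e / 4) *: const_mx 1), (e / 2).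
split=> [|y yQ]; first by rewrite divr_gt0.
apply: eA; split=> // i j; rewrite ord1; have := yQ j; rewrite !mxE mulr1 => /andP[y1 y2].
by rewrite /ball /= ltr_norml; apply/andP; split; lra.
Qed.

(** At a point of the dense box where [u] is nonzero the fibre determinant exceeds 3; by continuity
    it stays above the midpoint [c] on a whole cube. *)
Lemma area_gain_cube (u : NN -> R) : smooth_fun u -> (forall p, -1 < u p < 1) ->
  (exists p, u p != 0) -> exists a l e, [/\ 0 < l, 0 < e, cube a l `<=` box 0 &
    forall x, cube a l x -> Num.sqrt 3 + e <= Num.sqrt (fibre_det alpha beta (u (torus_pi x)))].
Proof.
move=> us u1 [p up].
have uc : continuous u := smooth_fun_continuous us.
have [v bv uv] : exists2 v : 'rV[R]_m.+3, box 0 v & u (torus_pi v) != 0.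
  apply: (@box0_dense p [set q | u q != 0]).
  have := uc p; move=> /(_ [set t | t != 0]); apply.
  by apply: open_nbhs_nbhs; split => //; exact: open_neq.
pose f x := fibre_det alpha beta (u (torus_pi x)).
have fv : 3 < f v by exact: fibre_det_gt3.
pose c := (3 + f v) / 2.
have c3 : 3 < c by rewrite /c; lra.
have cf : c < f v by rewrite /c; lra.
have fc : {for v, continuous f}.
  apply: (@continuous_comp _ _ _ (fun x => u (torus_pi x)) (fibre_det alpha beta)).
    exact: continuous_lift.
  exact: continuous_fibre_det.
have H1 : nbhs v [set x | c < f x] by exact: (fc _ (lt_nbhsr cf)).
have H2 : nbhs v (@box R m.+3 0) by apply: open_nbhs_nbhs; split=> //; exact: open_box.
have [a [l [l0 Q]]] := nbhs_cube (filterI H1 H2).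
exists a, l, (Num.sqrt c - Num.sqrt 3); split=> // [|x /Q[]//|x /Q[/= cx _]].
  by rewrite subr_gt0 ltr_sqrt// (lt_trans _ c3).
by rewrite addrC subrK ler_sqrt ?(ltW cx)// (le_trans _ (ltW cx))// ltW// (lt_trans _ c3).
Qed.

Lemma strictly_area_minimising_graph0 :
  @strictly_area_minimising R m.+4 MM g NN (graph (fun=> 0)) (fun=> fun=> delta_mx 0 tcoord).
Proof.
(* Radius [1 <= pi] keeps [u] away from the other zeros of [osc], at nonzero multiples of the
   period. *)
exists 1 => // u us u1 u0; exists (graph u); split.
- by move=> p; exact: graph_is_exp.
- exact: closed_hypersurface_graph.
pose D i := fresh_piece (R := R) (n := m.+4) NN i.
pose A i := iint ((fun=> (Num.sqrt 3)%:E) \_ (D i)).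
pose B i := iint ((fun x => (area_density g (graph u : NN -> MM) i x)%:E) \_ (D i)).
have sqrt3 : 0 <= Num.sqrt 3 :> R by exact: sqrtr_ge0.
have A0 i : (0 <= A i)%E.
  by apply: iint_ge0 => x; rewrite patchE; case: ifP.
have AB i : (A i <= B i)%E.
  apply: le_iint => x; first by rewrite patchE; case: ifP.
  rewrite !patchE; case: ifPn => //; rewrite inE => /fresh_piece_box bx.
  rewrite lee_fin; apply: le_trans (area_density_graph_ge us bx).
  by rewrite ler_sqrt ?fibre_det_ge3// (le_trans _ (fibre_det_ge3 _)).
have -> : area (n := m.+4) g (graph (fun=> 0) : NN -> MM) = (\sum_(0 <= i <oo) A i)%E.
  apply: eq_eseriesr => i _; congr iint; apply/funext => x; rewrite !patchE; case: ifPn => //.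
  by rewrite inE => /fresh_piece_box bx; rewrite area_density_graph0.
have -> : area (n := m.+4) g (graph u : NN -> MM) = (\sum_(0 <= i <oo) B i)%E by [].
have Afin i : (A i < +oo)%E.
  apply: (@le_lt_trans _ _ (iint ((fun=> (Num.sqrt 3)%:E) \_ (cube (\row_j corner i j) period)))).
    apply: le_iint => x; first by rewrite patchE; case: ifP.
    rewrite !patchE; case: ifPn => [|_]; last by case: ifP.
    rewrite inE => /fresh_piece_box bx; rewrite ifT// inE => j; rewrite mxE.
    by have /andP[/ltW -> /ltW ->] := bx j.
  by rewrite iint_cube ?ltry// ltW// period_gt0.
have AB0 : (A 0%N < B 0%N)%E.
  have [a [l [e [l0 e0 Q E]]]] := area_gain_cube us u1 u0.
  (* On the piece of chart [0] the density of the graph is at least that of the slice plus [e] on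
     the cube, and the cube contributes [e] times its positive volume. *)
  apply: (@lt_le_trans _ _ (A 0%N + iint ((fun=> e%:E) \_ (cube a l)))%E).
    rewrite lteDl ?ge0_fin_numE// iint_cube ?ltW// lte_fin mulr_gt0// exprn_gt0//.
  have e0' : (0 <= e%:E)%E by rewrite lee_fin ltW.
  apply: le_trans (iint_superadd _ _) _; try by move=> x; rewrite patchE; case: ifP.
  apply: le_iint => x.
    by rewrite adde_ge0// patchE; case: ifP => //; rewrite lee_fin ltW.
  rewrite !patchE /D fresh_piece0; case: ifPn => [|/negP]; rewrite inE => bx.
    case: ifPn => [|_].
      rewrite inE => cx; rewrite -EFinD lee_fin.
      by apply: le_trans (area_density_graph_ge us bx); exact: E.
    rewrite adde0 lee_fin; apply: le_trans (area_density_graph_ge us bx).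
    by rewrite ler_sqrt ?fibre_det_ge3// (le_trans _ (fibre_det_ge3 _)).
  by rewrite ifN ?adde0//; apply/negP; rewrite inE => /Q.
apply: lt_nneseries AB AB0 Afin _ => //.
by eexists => i /fresh_piece_ge Di; rewrite /A /D Di patch_set0; exact: iint0.
Qed.

End Area.

Theorem proposition9 (R : realType) (n : nat) (hn : (4 <= n)%N) :
  exists (M : manifold R n) (g : metric M) (Sigma : manifold R n.-1) (f : Sigma -> M)
    (nu : nat -> Sigma -> 'rV[R]_n) (S0 : R),
    [/\ closed_hypersurface f,
        unit_normal_field g f nu,
        (forall i x, cod M i x -> S0 <= scalar_curvature (g i) x),
        strictly_area_minimising g f nu
      & [/\ totally_geodesic g f nu,
            (forall i p, dom M i (f p) ->
               inner (ricci (g i) (crd M i (f p))) (nu i p) (nu i p) = 0)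
          & (forall i p, dom M i (f p) ->
               scalar_curvature (g i) (crd M i (f p)) = S0)]].
Proof.
case: n hn => [|[|[|[|m]]]] // _.
(* [- 6^-1] is [- beta^2 / (2 det h)] on the slice, where [beta = 1] and [det h = 3]. *)
exists (@torus_manifold R m.+4), (torus_metric m), (@torus_manifold R m.+3).
exists (graph (fun=> 0)), (fun=> fun=> delta_mx 0 tcoord), (- 6^-1); split.
- exact: closed_hypersurface_graph smooth_fun0.
- exact: unit_normal_graph0.
- by move=> i x _; rewrite [torus_metric m i]/= scalar_curvature_torus_gram scal_profile_ge.
- exact: strictly_area_minimising_graph0.
split; first exact: totally_geodesic_graph0.
- exact: ricci_normal_graph0.
- move=> i p /graph0_coord[k kE].
  rewrite [torus_metric m i]/= scalar_curvature_torus_gram kE.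
  by have [] := profile_at0 (@cos_periodZ R k) (@sin_periodZ R k).
Qed.
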